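(* Let $d\ge 1$ and let $\Omega\subset\mathbb R^d$ be a closed convex set with nonempty interior. Let $E:[0,\infty)\to(-\infty,+\infty]$ be lower semi-continuous and convex with $E(0)=0$, with $E(c_\circ)<\infty$ for some $c_\circ>0$, and of class $\mathrm C^2$ on the interior of its domain $\{c\ge0: E(c)<\infty\}$. Put $E'_\infty:=\lim_{c\to\infty}E(c)/c$ and $E'_0:=\lim_{c\downarrow 0}E(c)/c$; if $E_0'=-\infty$, assume in addition that $\Omega$ is bounded. Define $$\mathscr E(\mu)=\int_\Omega E(c(x))\,\mathrm dx+E'_\infty\,\mu^\perp(\Omega)\quad\text{for }\mu=c\,\mathcal L^d+\mu^\perp\in\mathcal M(\Omega),\ \ \mu^\perp\perp\mathcal L^d .$$ If $\mathscr E$ is geodesically convex on $(\mathcal M(\Omega),\mathsf{HK})$, then the function $$N_E(\rho,\gamma):=\Big(\frac\rho\gamma\Big)^dE\Big(\frac{\gamma^{d+2}}{\rho^d}\Big),\qquad \rho,\gamma>0,$$ is convex on $(0,\infty)^2$ (with values in $\mathbb R\cup\{\infty\}$), and for every $\gamma>0$ the map $\rho\mapsto(d-1)N_E(\rho,\gamma)$ is non-increasing on $(0,\infty)$ (a void condition if $d=1$).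
   Context: $\mathcal M(\Omega)$ is the set of finite nonnegative Borel measures on $\mathbb R^d$ with support contained in $\Omega$; $\mathcal L^d$ is Lebesgue measure; $\mu=c\mathcal L^d+\mu^\perp$ is the Lebesgue decomposition; the convention $\infty\cdot 0=0$ is used in the definition of $\mathscr E$. The Hellinger--Kantorovich distance $\mathsf{HK}$ between finite nonnegative Borel measures $\mu_0,\mu_1$ on $\mathbb R^d$ is given by $$\mathsf{HK}(\mu_0,\mu_1)^2=\min_{\boldsymbol\eta}\Big\{\int F(\sigma_0)\,\mathrm d\mu_0+\int F(\sigma_1)\,\mathrm d\mu_1+\iint \ell(|x_0-x_1|)\,\mathrm d\boldsymbol\eta(x_0,x_1)\Big\},$$ where $\boldsymbol\eta$ ranges over the finite nonnegative Borel measures on $\mathbb R^d\times\mathbb R^d$ whose marginals are of the form $\sigma_i\mu_i$ ($i=0,1$), $F(s)=s\log s-s+1$ for $s>0$, $F(0)=1$, and $\ell(r)=-\log(\cos^2 r)$ for $0\le r<\pi/2$, $\ell(r)=+\infty$ for $r\ge\pi/2$. (Equivalently, $\mathsf{HK}^2$ is the minimum of $\int_0^1\int(|\Upsilon|^2+4\xi^2)\,\mathrm d\mu_t\,\mathrm dt$ over solutions of $\partial_t\mu+\operatorname{div}(\mu\Upsilon)=4\xi\mu$ connecting $\mu_0$ to $\mu_1$.) A geodesic is a constant-speed curve $(\mu_t)_{t\in[0,1]}$ with $\mathsf{HK}(\mu_s,\mu_t)=|s-t|\,\mathsf{HK}(\mu_0,\mu_1)$ for all $s,t\in[0,1]$.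 A functional $\mathscr F:\mathcal M(\Omega)\to\mathbb R\cup\{\infty\}$ is geodesically convex if for every geodesic $(\mu_t)_{t\in[0,1]}$ in $(\mathcal M(\Omega),\mathsf{HK})$ and every $t\in[0,1]$: $\mathscr F(\mu_t)\le(1-t)\mathscr F(\mu_0)+t\mathscr F(\mu_1)$. *)

(* Defs.v *)
From HB Require Import structures.
From mathcomp Require Import all_boot all_order all_algebra.
From mathcomp Require Import all_classical all_reals all_analysis.
From mathcomp Require Import measurable_realfun.

Set Implicit Arguments.
Unset Strict Implicit.
Unset Printing Implicit Defensive.

Import Order.TTheory GRing.Theory Num.Theory.
Import numFieldNormedType.Exports.

Local Open Scope classical_set_scope.
Local Open Scope ring_scope.

(* R^d is 'rV[R]_d; matrices carry the Borel sigma-algebra of their topology. *)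
Section borel_matrix.
Variables (R : realType) (m n : nat).

Let B : set (set 'M[R]_(m, n)) := <<s open >>.

Let B0 : B set0.
Proof. exact: sigma_algebra0. Qed.

Let BC A : B A -> B (~` A).
Proof. exact: sigma_algebraC. Qed.

Let BU (F : (set 'M[R]_(m, n))^nat) :
  (forall i, B (F i)) -> B (\bigcup_i F i).
Proof. exact: sigma_algebra_bigcup. Qed.

HB.instance Definition _ :=
  @isMeasurable.Build default_measure_display 'M[R]_(m, n) B B0 BC BU.

End borel_matrix.

(* Lebesgue measure on R^d: built on tuples by iterated products, then
   transported to row vectors. *)
Lemma product_sigma_finite d1 d2 (T1 : measurableType d1)
    (T2 : measurableType d2) (R : realType)
    (m1 : {sigma_finite_measure set T1 -> \bar R})
    (m2 : {sigma_finite_measure set T2 -> \bar R}) :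
  sigma_finite setT (m1 \x m2)%E.
Proof.
have /sigma_finiteP[F [TF ndF Foo]] := sigma_finiteT m1.
have /sigma_finiteP[G [TG ndG Goo]] := sigma_finiteT m2.
exists (fun n => F n `*` G n).
  rewrite -setXTT TF TG predeqE => -[x y]; split.
    move=> [/= [n _ Fnx] [k _ Gky]]; exists (maxn n k) => //; split.
    - by move: x Fnx; exact/subsetPset/ndF/leq_maxl.
    - by move: y Gky; exact/subsetPset/ndG/leq_maxr.
  by move=> [n _ []/= ? ?]; split; exists n.
move=> k; have [? ?] := Foo k; have [? ?] := Goo k.
split; first exact: measurableX.
by rewrite product_measure1E// lte_mul_pinfty// ge0_fin_numE.
Qed.

Lemma pushforward_sigma_finite d1 d2 (T1 : measurableType d1)
    (T2 : measurableType d2) (R : realType)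
    (m : set T1 -> \bar R) (f : T1 -> T2) (g : T2 -> T1) :
  sigma_finite setT m -> cancel f g -> measurable_fun setT g ->
  sigma_finite setT (pushforward m f).
Proof.
move=> [F FT mF] fK mg.
exists (fun n => g @^-1` F n).
  by rewrite -preimage_bigcup -FT preimage_setT.
move=> n; have [mFn mFoo] := mF n; split.
  by rewrite -[X in measurable X]setTI; exact: mg.
rewrite /pushforward -comp_preimage.
by rewrite (_ : g \o f = id) ?preimage_id//; apply/funext => x /=; rewrite fK.
Qed.

Section lebesgue_tuple.
Variable R : realType.
Local Notation T := (measurableTypeR R).

Let consT n (p : T * n.-tuple T) : n.+1.-tuple T := [the _ of p.1 :: p.2].
Let unconsT n (t : n.+1.-tuple T) : T * n.-tuple T :=
  (thead t, [tuple of behead t]).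

Let consTK n : cancel (@consT n) (@unconsT n).
Proof. by case=> x t; congr pair; exact/val_inj. Qed.

Let measurable_consT n : measurable_fun setT (@consT n).
Proof. exact: measurable_cons. Qed.

Let measurable_unconsT n : measurable_fun setT (@unconsT n).
Proof.
apply/measurable_fun_pairP; split; first exact: measurable_tnth.
exact: measurable_behead.
Qed.

Definition lebesgue_cons n (m : {sigma_finite_measure set n.-tuple T -> \bar R})
  : set (n.+1.-tuple T) -> \bar R :=
  pushforward (lebesgue_measure \x m)%E (@consT n).

Section instances.
Variables (n : nat) (m : {sigma_finite_measure set n.-tuple T -> \bar R}).

Let cons0 : lebesgue_cons m set0 = 0%E.
Proof. by rewrite /lebesgue_cons /pushforward preimage_set0 measure0. Qed.

Let cons_ge0 A : (0 <= lebesgue_cons m A)%E.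
Proof. by rewrite /lebesgue_cons /pushforward; exact: measure_ge0. Qed.

Let cons_sigma_additive : semi_sigma_additive (lebesgue_cons m).
Proof.
move=> F mF tF mUF; rewrite /lebesgue_cons /pushforward preimage_bigcup.
apply: measure_semi_sigma_additive.
- by move=> k; rewrite -[X in measurable X]setTI; exact: measurable_consT.
- apply/trivIsetP => /= i j _ _ ij; rewrite -preimage_setI.
  by move/trivIsetP : tF => /(_ _ _ _ _ ij) ->//; rewrite preimage_set0.
- by rewrite -preimage_bigcup -[X in measurable X]setTI; exact: measurable_consT.
Qed.

HB.instance Definition _ := isMeasure.Build _ _ _ (lebesgue_cons m)
  cons0 cons_ge0 cons_sigma_additive.

Let cons_sigma_finite : sigma_finite setT (lebesgue_cons m).
Proof.
exact: (pushforward_sigma_finite (product_sigma_finite _ m) (@consTK n)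
  (@measurable_unconsT n)).
Qed.

HB.instance Definition _ :=
  @Measure_isSigmaFinite.Build _ _ _ (lebesgue_cons m) cons_sigma_finite.
End instances.

Fixpoint lebesgue_tuple n : {sigma_finite_measure set n.-tuple T -> \bar R} :=
  match n with
  | 0 => \d_([tuple] : 0.-tuple T)
  | n'.+1 => lebesgue_cons (lebesgue_tuple n')
  end.

End lebesgue_tuple.


Section lebesgue_rV.
Variables (R : realType) (d : nat).
Local Notation T := (measurableTypeR R).

Definition rV_of_tuple (t : d.-tuple T) : 'rV[R]_d := \row_i tnth t i.
Definition tuple_of_rV (v : 'rV[R]_d) : d.-tuple T := [tuple v ord0 i | i < d].

Lemma rV_of_tupleK : cancel rV_of_tuple tuple_of_rV.
Proof. by move=> t; apply: eq_from_tnth => i; rewrite tnth_mktuple mxE. Qed.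

Let ratV (q : 'rV[rat]_d) : 'rV[R]_d := \row_i ratr (q ord0 i).

Let open_bigcup (U : set 'rV[R]_d) : open U ->
  U = \bigcup_p [set x : 'rV[R]_d |
        let B := ball (ratV p.1) p.2.+1%:R^-1 in B `<=` U /\ B x].
Proof.
move=> oU; apply/seteqP; split=> [x Ux|x [p _ [pU /pU]]//].
have /nbhs_ballP[e /= e0 eU] : nbhs x U by move: oU; rewrite openE; exact.
have [k _ /(_ k (leqnn _)) /= ke] := near_infty_natSinv_lt (PosNum (divr_gt0 e0 (ltr0n R 2))).
rewrite /= in ke.
have k0 : 0 < k.+1%:R^-1 :> R by rewrite invr_gt0.
have /choice[q qx] (i : 'I_d) : exists q : rat, ball (x ord0 i) k.+1%:R^-1 (ratr q).
  have xlt : x ord0 i < x ord0 i + k.+1%:R^-1 by rewrite ltrDl.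
  have [q] := rat_in_itvoo xlt.
  rewrite in_itv/= => /andP[xq qx]; exists q.
  by rewrite /ball/= ltr_distlC qx andbT ltrBlDr (lt_trans xq)// ltrDl.
exists (\row_i q i, k) => //=.
have xB : ball (ratV (\row_i q i)) k.+1%:R^-1 x.
  by split=> // i j; rewrite ord1 !mxE; exact/ball_sym/qx.
split=> // y qy; apply: eU.
apply: (@le_ball _ _ _ (k.+1%:R^-1 + k.+1%:R^-1)).
  by rewrite [leRHS]splitr lerD// ltW.
by apply: ball_triangle qy; exact: ball_sym.
Qed.

Lemma measurable_rV_of_tuple : measurable_fun setT rV_of_tuple.
Proof.
apply: measurability => //.
move=> _ [U oU <-]; rewrite setTI (open_bigcup oU) preimage_bigcup.
apply: countable_bigcupT_measurable => [|[q k] /=]; first exact: countableP.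
set B := ball (ratV q) _.
have [BU|nBU] := pselect (B `<=` U); last first.
  by rewrite (_ : _ @^-1` _ = set0)//; apply/seteqP; split => // t [].
rewrite (_ : _ @^-1` _ =
    \bigcap_(i : 'I_d)
      ((@tnth d T)^~ i @^-1` ball (ratr (q ord0 i) : R) k.+1%:R^-1)); last first.
  apply/seteqP; split=> [t [_ [_ Bt]] i _|t Bt].
    by have := Bt ord0 i; rewrite !mxE.
  split=> //; split=> // i j; rewrite ord1 !mxE; exact: Bt.
apply: fin_bigcap_measurable => // i _.
rewrite -[X in measurable X]setTI; apply: measurable_tnth => //.
by apply: open_measurable; apply: ball_open; rewrite invr_gt0.
Qed.

Lemma measurable_tuple_of_rV : measurable_fun setT tuple_of_rV.
Proof.
apply/measurable_fun_tnthP => i.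
rewrite (_ : _ \o _ = fun v : 'rV[R]_d => v ord0 i); last first.
  by apply/funext => v /=; rewrite tnth_mktuple.
apply: (measurability _ (RGenOpens.measurableE R)).
move=> _ [_ [a [b ->] <-]]; rewrite setTI; apply: sub_sigma_algebra.
by move/continuousP : (@coord_continuous R 1 d ord0 i); apply;
exact: interval_open.
Qed.

Definition lebesgue_rV : set 'rV[R]_d -> \bar R :=
  pushforward (lebesgue_tuple R d) rV_of_tuple.

Let lebesgue_rV0 : lebesgue_rV set0 = 0%E.
Proof. by rewrite /lebesgue_rV /pushforward preimage_set0 measure0. Qed.

Let lebesgue_rV_ge0 A : (0 <= lebesgue_rV A)%E.
Proof. by rewrite /lebesgue_rV /pushforward; exact: measure_ge0. Qed.

Let lebesgue_rV_sigma_additive : semi_sigma_additive lebesgue_rV.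
Proof.
move=> F mF tF mUF; rewrite /lebesgue_rV /pushforward preimage_bigcup.
apply: measure_semi_sigma_additive.
- by move=> k; rewrite -[X in measurable X]setTI; exact: measurable_rV_of_tuple.
- apply/trivIsetP => /= i j _ _ ij; rewrite -preimage_setI.
  by move/trivIsetP : tF => /(_ _ _ _ _ ij) ->//; rewrite preimage_set0.
- rewrite -preimage_bigcup -[X in measurable X]setTI.
  exact: measurable_rV_of_tuple.
Qed.

HB.instance Definition _ := isMeasure.Build _ _ _ lebesgue_rV
  lebesgue_rV0 lebesgue_rV_ge0 lebesgue_rV_sigma_additive.

Let lebesgue_rV_sigma_finite : sigma_finite setT lebesgue_rV.
Proof.
exact: (pushforward_sigma_finite (sigma_finiteT (lebesgue_tuple R d))
  rV_of_tupleK measurable_tuple_of_rV).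
Qed.

HB.instance Definition _ :=
  @Measure_isSigmaFinite.Build _ _ _ lebesgue_rV lebesgue_rV_sigma_finite.

End lebesgue_rV.

Lemma lebesgue_tuple_box (R : realType) n (A : 'I_n -> set (measurableTypeR R)) :
  (forall i, measurable (A i)) ->
  lebesgue_tuple R n [set t | forall i, A i (tnth t i)] =
  (\prod_(i < n) lebesgue_measure (A i))%E.
Proof.
elim: n A => [|n IHn] A mA.
  by rewrite big_ord0 /= diracE mem_set// => -[].
rewrite big_ord_recl -IHn; last by move=> i; exact: mA.
rewrite /= -[RHS]product_measure1E//; last first.
  rewrite (_ : [set t | _] = \bigcap_(i : 'I_n)
      ((@tnth n (measurableTypeR R))^~ i @^-1` A (lift ord0 i))).
    apply: fin_bigcap_measurable => // i _.
    by rewrite -[X in measurable X]setTI; exact: measurable_tnth.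
  by apply/seteqP; split=> t /= At i; [move=> _|]; exact: At.
rewrite /lebesgue_cons /pushforward; congr ((_ \x _)%E _).
apply/seteqP; split=> [[x t] /= At|[x t] [/= Ax At] i].
  split=> [|i]; first by have := At ord0.
  by have := At (lift ord0 i); rewrite tnthS.
by have [j ->|->//] := unliftP ord0 i; rewrite tnthS; exact: At.
Qed.

Lemma lebesgue_rV_box (R : realType) d (A : 'I_d -> set R) :
  (forall i, measurable (A i)) ->
  lebesgue_rV [set v : 'rV[R]_d | forall i, A i (v ord0 i)] =
  (\prod_(i < d) lebesgue_measure (A i))%E.
Proof.
move=> mA; rewrite -lebesgue_tuple_box//.
rewrite /lebesgue_rV /pushforward; congr (lebesgue_tuple R d _).
by apply/seteqP; split=> t /= At i; have := At i; rewrite mxE.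
Qed.

Section hellinger_kantorovich.
Variables (R : realType) (d : nat).
Local Notation rV := 'rV[R]_d.
Local Notation fmeasure := {finite_measure set rV -> \bar R}.

Definition msupport (mu : set rV -> \bar R) : set rV :=
  [set x | forall U, open U -> U x -> (0 < mu U)%E].

Definition measures_on (Omega : set rV) : set fmeasure :=
  [set mu | msupport mu `<=` Omega].

(* The library norm on 'rV is the sup norm. *)
Definition enorm (x : rV) : R := Num.sqrt (\sum_(i < d) x ord0 i ^+ 2).

Definition entropyF (s : R) : R := if s == 0 then 1 else s * ln s - s + 1.

Definition hk_cost (r : R) : \bar R :=
  if r < pi / 2 then (- ln (cos r ^+ 2))%:E else +oo%E.

Definition is_density (sigma : rV -> R) :=
  measurable_fun setT sigma /\ forall x, 0 <= sigma x.

(* [sigma0] and [sigma1] are densities of the marginals of [eta] with respect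
   to [mu0] and [mu1]. The product sigma-algebra on [rV * rV] is the Borel one,
   by second countability. *)
Definition hk_plan (mu0 mu1 : fmeasure)
    (eta : {finite_measure set (rV * rV)%type -> \bar R}) (sigma0 sigma1 : rV -> R) :=
  [/\ is_density sigma0, is_density sigma1,
      forall A : set rV, measurable A ->
        eta (A `*` setT) = (\int[mu0]_(x in A) (sigma0 x)%:E)%E &
      forall A : set rV, measurable A ->
        eta (setT `*` A) = (\int[mu1]_(x in A) (sigma1 x)%:E)%E].

Definition hk_functional (mu0 mu1 : fmeasure)
    (eta : {finite_measure set (rV * rV)%type -> \bar R}) (sigma0 sigma1 : rV -> R) :
    \bar R :=
  (\int[mu0]_x (entropyF (sigma0 x))%:E + \int[mu1]_x (entropyF (sigma1 x))%:E
   + \int[eta]_z hk_cost (enorm (z.1 - z.2)))%E.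

(* The infimum is finite: [eta = 0] is admissible. *)
Definition HK (mu0 mu1 : fmeasure) : R :=
  Num.sqrt (fine (ereal_inf [set c | exists eta sigma0 sigma1,
    hk_plan mu0 mu1 eta sigma0 sigma1 /\
    c = hk_functional mu0 mu1 eta sigma0 sigma1])).

Definition hk_geodesic (Omega : set rV) (mu : R -> fmeasure) :=
  (forall t, 0 <= t <= 1 -> measures_on Omega (mu t)) /\
  (forall s t, 0 <= s <= 1 -> 0 <= t <= 1 ->
    HK (mu s) (mu t) = `|s - t| * HK (mu 0) (mu 1)).

Definition geodesically_convex (Omega : set rV) (G : fmeasure -> \bar R) :=
  forall mu, hk_geodesic Omega mu -> forall t, 0 <= t <= 1 ->
    (G (mu t) <= (1 - t)%:E * G (mu 0%R) + t%:E * G (mu 1%R))%E.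

(* [mu = c L^d + mup] with [mup] singular with respect to [L^d]. *)
Definition lebesgue_decomposition (mu : fmeasure) (c : rV -> R)
    (mup : fmeasure) :=
  [/\ is_density c,
      forall A : set rV, measurable A ->
        mu A = (\int[@lebesgue_rV R d]_(x in A) (c x)%:E + mup A)%E &
      exists N : set rV,
        [/\ measurable N, lebesgue_rV N = 0%E & mup (~` N) = 0%E]].

Definition slope_oo (E : R -> \bar R) : \bar R :=
  lim ((E c * (c^-1)%:E)%E @[c --> +oo%R]).

Definition slope_0 (E : R -> \bar R) : \bar R :=
  lim ((E c * (c^-1)%:E)%E @[c --> 0^'+]).

(* [v] below is unique: [c] is determined Lebesgue-a.e. and [mup] on Borel
   sets. In [\bar R], [+oo * 0 = 0]. *)
Definition energy (Omega : set rV) (E : R -> \bar R) (mu : fmeasure) : \bar R :=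
  get [set v : \bar R | exists c mup, lebesgue_decomposition mu c mup /\
    v = (\int[@lebesgue_rV R d]_(x in Omega) E (c x)
         + slope_oo E * mup Omega)%E].

Definition N_E (E : R -> \bar R) (rho gamma : R) : \bar R :=
  (((rho / gamma) ^+ d)%:E * E (gamma ^+ (d + 2) / rho ^+ d)%R)%E.

End hellinger_kantorovich.

(* Convexity of an extended-real-valued function, with values in ]-oo, +oo]. *)
Definition econvex_on (R : realType) (V : lmodType R) (D : set V)
    (f : V -> \bar R) :=
  (forall x, D x -> f x != -oo%E) /\
  (forall x y t, D x -> D y -> 0 <= t <= 1 ->
    (f ((1 - t) *: x + t *: y)%R <= (1 - t)%:E * f x + t%:E * f y)%E).

Definition C2_on (R : realType) (A : set R) (f : R -> R) :=
  forall x, A x -> [/\ derivable f x 1, derivable (derive1 f) x 1 &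
    {for x, continuous (derive1n 2 f)}].

(* Interior in R of the effective domain of [E : [0, +oo[ -> \bar R]. *)
Definition dom_interior (R : realType) (E : R -> \bar R) : set R :=
  [set c : R | 0 <= c /\ (E c < +oo)%E]°.

(* Main.v *)
Require Import Defs.
From HB Require Import structures.
From mathcomp Require Import all_boot all_order all_algebra.
From mathcomp Require Import all_classical all_reals all_analysis.
From mathcomp Require Import measurable_realfun ring lra.

Set Implicit Arguments.
Unset Strict Implicit.
Unset Printing Implicit Defensive.

Import Order.TTheory GRing.Theory Num.Theory.
Import numFieldNormedType.Exports.

Local Open Scope classical_set_scope.
Local Open Scope ring_scope.

(* Write N(rho, gamma) = gamma^2 E(c) / c with c = gamma^(d+2) / rho^d. Convexity
   of E and E(0) = 0 make E(c) / c nondecreasing, which gives the monotonicity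
   in rho.
   For convexity, lift x near an interior point x0 of Omega to the cone: in the
   half-plane spanned by the apex axis and the ray from x0 through x, a mass
   element q^2 at x becomes the vector q (cos |x - x0|, sin |x - x0|). Moving
   these vectors by diag(gamma_t, rho_t), with gamma_t and rho_t affine in t,
   gives an exact HK geodesic: the quadratic forms of diag(gamma_t / gamma_s,
   rho_t / rho_s) and of its inverse are dual potentials, by Cauchy-Schwarz and
   | |x - x0| - |y - x0| | <= |x - y|. Started from a constant density on a ball
   of radius D in the tangent coordinates y = (gamma_t / rho_t) tan |x - x0|, the
   density at time t is c_t times a factor tending to 1 as D -> 0, and the mass
   is asymptotically proportional to gamma_t^2; the energy inequality along
   the geodesic becomes the convexity inequality for N. *)

(** * Densities and images of measures *)

(** A displaced cone vector with coordinates (gamma, rho |y|) has angle theta with tan theta = (rho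
    / gamma) |y|. So in tangent coordinates a diagonal motion is a mere dilation by rho / gamma,
    while the mass near x0 is gamma^2 per unit of y. Hence c = gamma^2 (gamma / rho)^d, which
    explains the exponent d + 2, and gamma^2 E(c) / c is mass times energy per unit mass. The
    obstacle is that the displaced density is not constant, so the energies have no closed form.
    They are bounded instead of computed. The initial weight carries a constant m <= 1 that absorbs
    the distortion, so that at every time s the density is either 0 or between m c_s and c_s. As
    E(c) / c is nondecreasing, the energies at both ends are at most E(c_s) / c_s times the mass,
    and the energy at time t is at least E(m c_t) / (m c_t) times the mass. No limit of integrals is
    taken: D -> 0 and m -> 1 act on an inequality between real numbers, and lower semicontinuity of
    E at c_t closes the argument. *)

Section density.
Context d (T : measurableType d) (R : realType).
Variables (mu nu : {measure set T -> \bar R}) (h : T -> R).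
Hypotheses (mh : measurable_fun setT h) (h0 : forall x, 0 <= h x).
Hypothesis nuE :
  forall A, measurable A -> nu A = (\int[mu]_(x in A) (h x)%:E)%E.
Import HBNNSimple.
Local Open Scope ereal_scope.

Lemma ge0_integral_density (f : T -> \bar R) : measurable_fun setT f ->
  (forall x, 0 <= f x) ->
  \int[nu]_x f x = \int[mu]_x (f x * (h x)%:E).
Proof.
move=> mf f0.
pose f_ := nnsfun_approx measurableT mf.
have mhE : measurable_fun setT (EFin \o h) by exact/measurable_EFinP.
have mfh n : measurable_fun setT (fun x => (f_ n x)%:E * (h x)%:E).
  by apply: emeasurable_funM => //; exact/measurable_EFinP.
transitivity (limn (fun n => \int[nu]_x (f_ n x)%:E)).
  rewrite -monotone_convergence//=.
  - apply: eq_integral => y _; apply/esym/cvg_lim => //.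
    exact: cvg_nnsfun_approx.
  - by move=> n; exact/measurable_EFinP/measurable_funP.
  - by move=> n y _; rewrite lee_fin.
  - by move=> y _ m n mn; rewrite lee_fin; exact/lefP/nd_nnsfun_approx.
transitivity (limn (fun n => \int[mu]_x ((f_ n x)%:E * (h x)%:E))); last first.
  rewrite -monotone_convergence//=.
  - apply: eq_integral => y _; apply/cvg_lim => //.
    by apply: cvgeZr => //; exact: cvg_nnsfun_approx.
  - by move=> n y _; rewrite mule_ge0 ?lee_fin.
  - move=> y _ m n mn; apply: lee_wpmul2r; rewrite ?lee_fin//.
    exact/lefP/nd_nnsfun_approx.
congr (limn _); apply/funext => n.
under eq_integral do rewrite fimfunE -fsumEFin//.
rewrite ge0_integral_fsum//; last 2 first.
  - by move=> y; exact/measurable_EFinP/measurable_funM.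
  - by move=> y x _; rewrite nnfun_muleindic_ge0.
rewrite [RHS](_ : _ = \int[mu]_x \sum_(r \in range (f_ n))
    ((r * \1_(f_ n @^-1` [set r]) x)%:E * (h x)%:E)); last first.
  apply: eq_integral => x _; rewrite fimfunE -fsumEFin// ge0_mule_fsuml//.
  by move=> r; exact: nnfun_muleindic_ge0.
rewrite ge0_integral_fsum//; last 2 first.
  - move=> y; apply: emeasurable_funM => //.
    exact/measurable_EFinP/measurable_funM.
  - move=> y x _; apply: mule_ge0; last by rewrite lee_fin.
    exact: nnfun_muleindic_ge0.
apply: eq_fsbigr => r _.
have [r0|r0] := ltP r 0%R.
  rewrite preimage_nnfun0// indic0 !integral0_eq//.
  - by move=> x _; rewrite mulr0 mul0e.
  - by move=> x _; rewrite mulr0.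
rewrite integralZl_indic_nnsfun// integral_indic// setIT nuE//.
under [RHS]eq_integral do rewrite EFinM -muleA.
rewrite ge0_integralZl_EFin//; last 2 first.
  - by move=> x _; rewrite mule_ge0// lee_fin.
  - by apply: emeasurable_funM => //; exact/measurable_EFinP.
congr (_ * _); rewrite integral_mkcond.
apply: eq_integral => x _; rewrite patchE indicE.
by case: ifPn; rewrite ?mul1e ?mul0e.
Qed.
End density.

Lemma weighted_image_measure d1 d2 (X : measurableType d1)
    (Y : measurableType d2) (R : realType) (mu : {measure set X -> \bar R})
    (P : X -> Y) (h : X -> R) :
  measurable_fun setT P -> measurable_fun setT h -> (forall x, 0 <= h x) ->
  exists nu : {measure set Y -> \bar R},
    (forall A, measurable A -> nu A = (\int[mu]_(x in P @^-1` A) (h x)%:E)%E) /\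
    (forall f : Y -> \bar R, measurable_fun setT f -> (forall y, 0 <= f y)%E ->
       (\int[nu]_y f y = \int[mu]_x (f (P x) * (h x)%:E))%E).
Proof.
move=> mP mh h0.
have mhE : measurable_fun setT (EFin \o h) by exact/measurable_EFinP.
pose w := fun A : set X => (\int[mu]_(x in A) (h x)%:E)%E.
have w0 : w set0 = 0%E by rewrite /w integral_set0.
have wge0 A : (0 <= w A)%E by apply: integral_ge0 => x _; rewrite lee_fin.
have wsig : semi_sigma_additive w.
  by apply: semi_sigma_additive_nng_induced => // x; rewrite lee_fin.
pose wM : {measure set X -> \bar R} :=
  HB.pack w (isMeasure.Build _ _ _ w w0 wge0 wsig).
have mPA (A : set Y) : measurable A -> measurable (P @^-1` A).
  by move=> mA; rewrite -[X in measurable X]setTI; exact: mP.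
pose n := fun A : set Y => w (P @^-1` A).
have n0 : n set0 = 0%E by rewrite /n preimage_set0.
have nge0 A : (0 <= n A)%E by exact: (wge0 _).
have nsig : semi_sigma_additive n.
  move=> F mF tF mUF; rewrite /n preimage_bigcup.
  apply: (wsig).
  - by move=> k; exact: mPA.
  - apply/trivIsetP => /= i j _ _ ij; rewrite -preimage_setI.
    by move/trivIsetP : tF => /(_ _ _ _ _ ij) ->//; rewrite preimage_set0.
  - by rewrite -preimage_bigcup; exact: mPA.
pose nM : {measure set Y -> \bar R} :=
  HB.pack n (isMeasure.Build _ _ _ n n0 nge0 nsig).
exists nM; split => // f mf f0.
have -> : (\int[mu]_x (f (P x) * (h x)%:E) = \int[wM]_x (f \o P) x)%E.
  rewrite (@ge0_integral_density _ _ _ mu wM h mh h0 _ (f \o P))//.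
    exact: (measurableT_comp mf mP).
  by move=> x; exact: f0.
exact: (@ge0_integral_pushforward _ _ _ _ _ P mP wM setT f).
Qed.

(** Source of every finite measure constructed below: the measures along the geodesic, the optimal
    plans, and the zero measure. *)
Lemma finite_weighted_image_measure d1 d2 (X : measurableType d1)
    (Y : measurableType d2) (R : realType) (mu : {measure set X -> \bar R})
    (P : X -> Y) (h : X -> R) :
  measurable_fun setT P -> measurable_fun setT h -> (forall x, 0 <= h x) ->
  (\int[mu]_x (h x)%:E < +oo)%E ->
  exists nu : {finite_measure set Y -> \bar R},
    (forall A, measurable A -> nu A = (\int[mu]_(x in P @^-1` A) (h x)%:E)%E) /\
    (forall f : Y -> \bar R, measurable_fun setT f -> (forall y, 0 <= f y)%E ->
       (\int[nu]_y f y = \int[mu]_x (f (P x) * (h x)%:E))%E).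
Proof.
move=> mP mh h0 hoo; have [n [nE nI]] := weighted_image_measure mu mP mh h0.
have nfin : fin_num_fun n.
  move=> A mA; rewrite ge0_fin_numE// nE//; apply: le_lt_trans hoo.
  apply: ge0_subset_integral => //.
  - by rewrite -[X in measurable X]setTI; exact: mP.
  - exact/measurable_EFinP.
  - by move=> x _; rewrite lee_fin.
pose f := fun A : set Y => n A.
have f0 : f set0 = 0%E by exact: measure0.
have fge0 A : (0 <= f A)%E by exact: measure_ge0.
have fsig : semi_sigma_additive f by exact: (@measure_semi_sigma_additive _ _ _ n).
pose fM : {measure set Y -> \bar R} :=
  HB.pack f (isMeasure.Build _ _ _ f f0 fge0 fsig).
pose fF : {finite_measure set Y -> \bar R} :=
  HB.pack f (isMeasure.Build _ _ _ f f0 fge0 fsig)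
    (Measure_isFinite.Build _ _ _ fM nfin).
by exists fF; split => // g mg g0; rewrite -nI.
Qed.

(** * Lebesgue measure on row vectors *)

Section rV_measurability.
Context d0 (X : measurableType d0) (R : realType) (d : nat).

Lemma measurable_rV_coord (i : 'I_d) :
  measurable_fun setT (fun v : 'rV[R]_d => v ord0 i).
Proof.
rewrite (_ : (fun v : 'rV[R]_d => v ord0 i) =
  (fun t : d.-tuple (measurableTypeR R) => tnth t i) \o (@tuple_of_rV R d)).
  apply: measurableT_comp; first exact: measurable_tnth.
  exact: measurable_tuple_of_rV.
by apply/funext => v /=; rewrite tnth_mktuple.
Qed.

Lemma measurable_rVP (f : X -> 'rV[R]_d) :
  (forall i, measurable_fun setT (fun x => f x ord0 i)) -> measurable_fun setT f.
Proof.
move=> mf.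
rewrite (_ : f = (@rV_of_tuple R d) \o ((@tuple_of_rV R d) \o f)).
  apply: measurableT_comp; first exact: measurable_rV_of_tuple.
  apply/measurable_fun_tnthP => i.
  rewrite (_ : _ \o _ = (fun x => f x ord0 i)); first exact: mf.
  by apply/funext => x /=; rewrite tnth_mktuple.
apply/funext => x /=; apply/rowP => i.
by rewrite mxE tnth_mktuple.
Qed.

Lemma measurable_enorm (f : X -> 'rV[R]_d) : measurable_fun setT f ->
  measurable_fun setT (fun x => enorm (f x)).
Proof.
move=> mf; rewrite /enorm.
have ms : measurable_fun setT (@Num.sqrt R).
  by apply: continuous_measurable_fun; exact: sqrt_continuous.
apply: (measurableT_comp ms); apply: measurable_sum => i.
apply: measurable_funX; exact: (measurableT_comp (@measurable_rV_coord i) mf).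
Qed.

Lemma measurable_rVD (f g : X -> 'rV[R]_d) : measurable_fun setT f ->
  measurable_fun setT g -> measurable_fun setT (fun x => f x + g x).
Proof.
move=> mf mg; apply: measurable_rVP => i.
under eq_fun do rewrite mxE.
by apply: measurable_funD; exact: (measurableT_comp (@measurable_rV_coord i)).
Qed.

Lemma measurable_rVN (f : X -> 'rV[R]_d) : measurable_fun setT f ->
  measurable_fun setT (fun x => - f x).
Proof.
move=> mf; apply: measurable_rVP => i.
under eq_fun do rewrite mxE.
apply: measurable_funN; exact: (measurableT_comp (@measurable_rV_coord i)).
Qed.

Lemma measurable_rVZ (a : X -> R) (f : X -> 'rV[R]_d) : measurable_fun setT a ->
  measurable_fun setT f -> measurable_fun setT (fun x => a x *: f x).
Proof.
move=> ma mf; apply: measurable_rVP => i.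
under eq_fun do rewrite mxE.
by apply: measurable_funM => //; exact: (measurableT_comp (@measurable_rV_coord i)).
Qed.

End rV_measurability.

(** Makes the right-hand sides of the affine scaling formulas into measures, so that uniqueness on
    intervals or on rectangles can identify them with Lebesgue measure. *)
Lemma scaled_image_measure d1 d2 (X : measurableType d1)
    (Y : measurableType d2) (R : realType) (m : {measure set X -> \bar R})
    (f : X -> Y) (k : R) : measurable_fun setT f -> 0 <= k ->
  exists n : {measure set Y -> \bar R}, forall A, n A = (k%:E * m (f @^-1` A))%E.
Proof.
move=> mf k0.
have mfA (A : set Y) : measurable A -> measurable (f @^-1` A).
  by move=> mA; rewrite -[X in measurable X]setTI; exact: mf.
pose n := fun A => (k%:E * m (f @^-1` A))%E.
have n0 : n set0 = 0%E by rewrite /n preimage_set0 measure0 mule0.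
have nge0 A : (0 <= n A)%E by apply: mule_ge0; rewrite ?lee_fin.
have nsig : semi_sigma_additive n.
  move=> F mF tF mUF; rewrite /n preimage_bigcup.
  under eq_fun do rewrite -ge0_sume_distrr//.
  apply: cvgeZl => //; apply: measure_semi_sigma_additive.
  - by move=> i; exact: mfA.
  - apply/trivIsetP => /= i j _ _ ij; rewrite -preimage_setI.
    by move/trivIsetP : tF => /(_ _ _ _ _ ij) ->//; rewrite preimage_set0.
  - by rewrite -preimage_bigcup; exact: mfA.
pose nM : {measure set Y -> \bar R} :=
  HB.pack n (isMeasure.Build _ _ _ n n0 nge0 nsig).
by exists nM.
Qed.

Section lebesgue_affine.
Variable R : realType.
Local Notation T := (measurableTypeR R).

Lemma lebesgue_measure_affine (s b : R) (A : set T) : 0 < s -> measurable A ->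
  lebesgue_measure A =
    (s%:E * lebesgue_measure ((fun x : T => (b + s * x)%R) @^-1` A))%E.
Proof.
move=> s0 mA.
have mf : measurable_fun setT (fun x : T => (b + s * x)%R : T).
  by apply: measurable_funD => //; exact: measurable_funM.
have [n nE] := scaled_image_measure lebesgue_measure mf (ltW s0).
rewrite -nE; apply: lebesgue_measure_unique => // _ [[x y]] _ <-.
rewrite [RHS]nE.
rewrite (_ : _ @^-1` _ = `](x - b) / s, (y - b) / s]%classic); last first.
  apply/seteqP; split => z /=; rewrite !in_itv/=;
    by rewrite ltr_pdivrMr// ler_pdivlMr// ltrBlDl lerBrDl (mulrC z).
rewrite lebesgue_measure_itv/= [in RHS]lebesgue_measure_itv/= !lte_fin.
rewrite ltr_pM2r ?invr_gt0// ltrD2r.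
case: ifPn => _; last by rewrite mule0.
rewrite -!EFinD -EFinM; congr EFin.
by field; rewrite gt_eqF.
Qed.

(** Induction along the iterated product: the scaled image measure agrees with the product on
    rectangles, by the one-dimensional formula for the first factor and the induction hypothesis for
    the others. *)
Lemma lebesgue_tuple_affine n (s : R) (b : 'I_n -> R) (A : set (n.-tuple T)) :
  0 < s -> measurable A ->
  lebesgue_tuple R n A = ((s ^+ n)%:E * lebesgue_tuple R n
     ((fun t => [tuple (b i + s * tnth t i)%R : T | i < n]) @^-1` A))%E.
Proof.
move=> s0; elim: n b A => [|n IHn] b A mA.
  rewrite expr0 mul1e /=; congr (\d_ _ _); apply/seteqP; split => t /=;
    by rewrite (tuple0 t) (tuple0 [tuple _ | i < 0]).
pose f0 (x : T) : T := b ord0 + s * x.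
pose f1 (t : n.-tuple T) : n.-tuple T := [tuple b (lift ord0 i) + s * tnth t i | i < n].
pose f (p : T * n.-tuple T) := (f0 p.1, f1 p.2).
have mf1 : measurable_fun setT f1.
  apply/measurable_fun_tnthP => i.
  rewrite (_ : _ \o _ = fun t : n.-tuple T => b (lift ord0 i) + s * tnth t i); last first.
    by apply/funext => t /=; rewrite tnth_mktuple.
  apply: measurable_funD => //; apply: measurable_funM => //.
  exact: measurable_tnth.
have mf0 : measurable_fun setT f0.
  by apply: measurable_funD => //; exact: measurable_funM.
have mf : measurable_fun setT f.
  apply/measurable_fun_pairP; split.
    exact: (measurableT_comp mf0 measurable_fst).
  exact: (measurableT_comp mf1 measurable_snd).
have sn0 : 0 <= s ^+ n.+1 by rewrite exprn_ge0// ltW.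
have [m mE] := scaled_image_measure (lebesgue_measure \x lebesgue_tuple R n)%E mf sn0.
rewrite /= /lebesgue_cons /pushforward.
have consE (p : T * n.-tuple T) :
    [tuple of (f p).1 :: (f p).2] =
    [tuple b i + s * tnth [tuple of p.1 :: p.2] i | i < n.+1] :> n.+1.-tuple T.
  apply: eq_from_tnth => i; rewrite tnth_mktuple.
  have [j ->|->//] := unliftP ord0 i.
  by rewrite !tnthS tnth_mktuple.
rewrite (product_measure_unique (m' := m)).
- rewrite mE; congr (_ * (_ \x _) _)%E.
  by apply/seteqP; split => p /=; rewrite -/(f p) => Ap;
    [rewrite -consE|rewrite -consE in Ap].
- move=> B C mB mC; rewrite mE.
  rewrite (_ : f @^-1` (B `*` C) = (f0 @^-1` B) `*` (f1 @^-1` C))//.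
  have mfB : measurable (f0 @^-1` B) by rewrite -[X in measurable X]setTI; exact: mf0.
  have mfC : measurable (f1 @^-1` C) by rewrite -[X in measurable X]setTI; exact: mf1.
  rewrite [X in (_ * X)%E](_ : _ = (lebesgue_measure (f0 @^-1` B) *
      lebesgue_tuple R n (f1 @^-1` C))%E).
    rewrite exprS EFinM muleACA; congr (_ * _)%E; apply/esym.
      exact: (lebesgue_measure_affine (b ord0) s0 mB).
    exact: (IHn (fun i => b (lift ord0 i)) _ mC).
  exact: product_measure1E.
- rewrite -[X in measurable X]setTI; apply: measurable_cons => //.
Qed.

Lemma lebesgue_rV_affine d (s : R) (b : 'rV[R]_d) (A : set 'rV[R]_d) :
  0 < s -> measurable A ->
  lebesgue_rV A = ((s ^+ d)%:E * lebesgue_rV ((fun x => (b + s *: x)%R) @^-1` A))%E.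
Proof.
move=> s0 mA; rewrite /lebesgue_rV /pushforward.
rewrite (lebesgue_tuple_affine (fun i => b ord0 i) s0); last first.
  by rewrite -[X in measurable X]setTI; exact: measurable_rV_of_tuple.
apply: (congr1 (fun Z => ((s ^+ d)%:E * lebesgue_tuple R d Z)%E)).
have e (t : d.-tuple T) :
    rV_of_tuple [tuple (b ord0 i + s * tnth t i)%R : T | i < d] =
    b + s *: rV_of_tuple t.
  by apply/rowP => i; rewrite !mxE tnth_mktuple.
by apply/funext => t; rewrite /preimage/= e.
Qed.

Lemma ge0_integral_lebesgue_rV_affine d (s : R) (b : 'rV[R]_d)
    (f : 'rV[R]_d -> \bar R) :
  0 < s -> measurable_fun setT f -> (forall x, 0 <= f x)%E ->
  (\int[@lebesgue_rV R d]_x f (b + s *: x)%R =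
   (s ^- d)%:E * \int[@lebesgue_rV R d]_x f x)%E.
Proof.
move=> s0 mf f0.
have mg : measurable_fun setT (fun x : 'rV[R]_d => b + s *: x).
  apply: measurable_rVD => //; apply: measurable_rVZ => //.
rewrite -(@ge0_integral_pushforward _ _ _ _ _ _ mg (@lebesgue_rV R d) setT f)//.
have sd0 : 0 <= s ^- d by rewrite invr_ge0 exprn_ge0// ltW.
pose k : {nonneg R} := NngNum sd0.
rewrite (eq_measure_integral (mscale k (@lebesgue_rV R d))); last first.
  move=> A mA _.
  transitivity ((s ^- d)%:E * ((s ^+ d)%:E *
      lebesgue_rV ((fun x => (b + s *: x)%R) @^-1` A)))%E.
    by rewrite muleA -EFinM mulVf ?mul1e// gt_eqF// exprn_gt0.
  by rewrite -lebesgue_rV_affine.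
by rewrite ge0_integral_mscale.
Qed.

End lebesgue_affine.

(** * Trigonometric functions and the substitution by the tangent on the line *)

Section realfun.
Variable R : realType.

Lemma measurable_invr : measurable_fun setT (fun x : R => x^-1).
Proof.
(* The square makes the base of the power nonnegative. At 0 both sides are 0. *)
rewrite (_ : (fun x : R => x^-1) = (fun x => x * (x ^+ 2) `^ (-1))).
  apply: measurable_funM => //.
  apply: (measurableT_comp (measurable_powR (-1))).
  exact: measurable_funX.
apply/funext => x; rewrite powR_inv1 ?sqr_ge0//.
have [->|x0] := eqVneq x 0; first by rewrite invr0 mul0r.
by rewrite expr2 invfM mulrA divff// mul1r.
Qed.

Lemma measurable_cosr : measurable_fun setT (@cos R).
Proof. apply: continuous_measurable_fun; exact: continuous_cos. Qed.

Lemma measurable_sinr : measurable_fun setT (@sin R).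
Proof. apply: continuous_measurable_fun; exact: continuous_sin. Qed.

Lemma measurable_tanr : measurable_fun setT (@tan R).
Proof.
apply: measurable_funM; first exact: measurable_sinr.
exact: (measurableT_comp measurable_invr measurable_cosr).
Qed.

Lemma measurable_atanr : measurable_fun setT (@atan R).
Proof. apply: continuous_measurable_fun; exact: continuous_atan. Qed.

Lemma cos_gt0_itv (x : R) : x \in `](- (pi / 2)), (pi / 2)[ -> cos x != 0.
Proof. by rewrite in_itv/= => ?; rewrite gt_eqF// cos_gt0_pihalf. Qed.

Local Notation D := `](- (pi / 2) : R), (pi / 2)[%classic.

Lemma integral_tan_cov (a b : R) : a < b ->
  (\int[lebesgue_measure]_(x in `[atan a, atan b]) (1 + tan x ^+ 2)%:E =
   (b - a)%:E)%E.
Proof.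
move=> ab.
have sub x : atan a <= x <= atan b -> x \in `](- (pi / 2)), (pi / 2)[.
  move=> /andP[ax xb]; rewrite in_itv/= (lt_le_trans (atan_gtNpi2 a))//=.
  by rewrite (le_lt_trans xb)// atan_ltpi2.
have ct x : atan a <= x <= atan b -> {for x, continuous (@tan R)}.
  by move=> /sub/cos_gt0_itv; exact: continuous_tan.
rewrite (@continuous_FTC2 _ _ (@tan R))//.
- by rewrite !atanK EFinB.
- exact: lt_atan.
- apply/subspace_continuousP => x /=; rewrite in_itv/= => xab.
  apply: cvg_within_filter.
  apply: cvgD; first exact: cvg_cst.
  have : {for x, continuous (fun y => tan y * tan y)}.
    by apply: cvgM; exact: ct.
  by rewrite (_ : (fun y => tan y * tan y) = (fun y => tan y ^+ 2)).
- split.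
  + move=> x; rewrite in_itv/= => /andP[xa xb]; apply: derivable_tan.
    by apply/cos_gt0_itv/sub; rewrite !ltW.
  + apply: cvg_within_filter; apply: ct.
    by rewrite lexx/= ltW// lt_atan.
  + apply: cvg_within_filter; apply: ct.
    by rewrite lexx/= ltW// lt_atan.
- move=> x; rewrite in_itv/= => /andP[xa xb].
  have c0 : cos x != 0 by apply/cos_gt0_itv/sub; rewrite !ltW.
  rewrite derive1E; have /@derive_val -> := is_derive_tan c0.
  by rewrite cos2_tan2.
Qed.

(** Lebesgue measure is the image under tan of the measure (1 + tan^2 x) dx on the principal branch:
    by [integral_tan_cov] the two agree on intervals, and uniqueness does the rest. *)
Lemma ge0_integral_tan (G : R -> \bar R) : measurable_fun setT G ->
  (forall x, 0 <= G x)%E ->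
  (\int[lebesgue_measure]_x G x =
   \int[lebesgue_measure]_(x in D) (G (tan x) * (1 + tan x ^+ 2)%:E))%E.
Proof.
move=> mG G0.
(* As tan is periodic, the preimage of an interval has infinitely many components; the indicator
   keeps the one on the principal branch. *)
pose h x : R := (\1_D x) * (1 + tan x ^+ 2).
have mh : measurable_fun setT h.
  apply: measurable_funM; first exact: measurable_indic.
  by apply: measurable_funD => //; apply: measurable_funX; exact: measurable_tanr.
have h0 x : 0 <= h x by rewrite /h mulr_ge0// addr_ge0// sqr_ge0.
have [n [nE nI]] := @weighted_image_measure _ _ (measurableTypeR R) (measurableTypeR R) R
  (@lebesgue_measure R) _ _ measurable_tanr mh h0.
rewrite (eq_measure_integral n); last first.
  move=> A mA _; apply: lebesgue_measure_unique => // _ [[x y] _ <-].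
  rewrite lebesgue_measure_itv/= lte_fin.
  rewrite nE//=; case: ltP => [xy|yx]; last first.
    rewrite set_itv_ge ?preimage_set0 ?integral_set0//.
    by rewrite bnd_simp -leNgt.
  rewrite -EFinB -(integral_tan_cov xy).
  rewrite -integral_itv_obnd_cbnd; last first.
    apply: measurable_funTS; apply/measurable_EFinP; apply: measurable_funD => //.
    by apply: measurable_funX; exact: measurable_tanr.
  rewrite [LHS]integral_mkcond [RHS]integral_mkcond.
  apply: eq_integral => z _; rewrite !patchE.
  have -> : (z \in tan @^-1` `]x, y]%classic) = (x < tan z <= y).
    by apply/idP/idP => [/set_mem/=|zxy]; [|apply/mem_set => /=]; rewrite in_itv.
  rewrite mem_setE in_itv/= /h indicE mem_setE.
  have [zD|zD] := boolP (z \in `](- (pi / 2)), (pi / 2)[).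
    rewrite mul1r -[in RHS](atanK x) -[in RHS](atanK y).
    have atanD (w : R) : atan w \in `](- (pi / 2)), (pi / 2)[.
      by rewrite in_itv/= atan_gtNpi2 atan_ltpi2.
    by rewrite ltr_tan// (leNgt (tan z)) ltr_tan// -leNgt.
  rewrite mul0r; case: ifPn => [/andP[zx zy]|_]; last by case: ifPn.
  move: zD; rewrite in_itv/= (lt_trans (atan_gtNpi2 x))//=.
  by rewrite (le_lt_trans zy (atan_ltpi2 y)).
rewrite nI// [RHS]integral_mkcond; apply: eq_integral => x _.
rewrite patchE /h indicE; case: ifPn => _; rewrite ?mul1r//.
by rewrite mul0r mule0.
Qed.
End realfun.

(** * Polar coordinates *)

Section enorm_theory.
Variables (R : realType) (d : nat).
Implicit Types x y : 'rV[R]_d.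

Lemma enorm_ge0 x : 0 <= enorm x.
Proof. exact: sqrtr_ge0. Qed.

Lemma sqr_enorm x : enorm x ^+ 2 = \sum_(i < d) x ord0 i ^+ 2.
Proof. by rewrite sqr_sqrtr// sumr_ge0// => i _; exact: sqr_ge0. Qed.

Lemma enormZ (a : R) x : enorm (a *: x) = `|a| * enorm x.
Proof.
apply/eqP; rewrite -(eqrXn2 (n := 2))// ?enorm_ge0 ?mulr_ge0 ?enorm_ge0//.
rewrite exprMn !sqr_enorm real_normK ?num_real// mulr_sumr.
by apply/eqP/eq_bigr => i _; rewrite mxE exprMn.
Qed.

Lemma enormN x : enorm (- x) = enorm x.
Proof. by rewrite -scaleN1r enormZ normrN1 mul1r. Qed.

Lemma ler_coord_enorm x i : `|x ord0 i| <= enorm x.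
Proof.
rewrite -(ler_pXn2r (n := 2))// ?nnegrE ?enorm_ge0//.
rewrite sqr_enorm real_normK ?num_real// (bigD1 i)//= lerDl sumr_ge0// => j _.
exact: sqr_ge0.
Qed.

Lemma enorm_eq0 x : (enorm x == 0) = (x == 0).
Proof.
apply/idP/eqP => [/eqP x0|->].
  apply/rowP => i; rewrite mxE; apply/eqP; rewrite -normr_eq0 eq_le normr_ge0 andbT.
  by rewrite -x0 ler_coord_enorm.
by rewrite /enorm big1 ?sqrtr0// => i _; rewrite mxE expr0n.
Qed.

Lemma enorm_le_coord x r : (0 < d)%N -> (forall i, `|x ord0 i| <= r) ->
  enorm x <= d%:R * r.
Proof.
move=> d0 xr.
have r0 : 0 <= r by apply: le_trans (xr (Ordinal d0)).
rewrite -(ler_pXn2r (n := 2))// ?nnegrE ?enorm_ge0// ?mulr_ge0//.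
rewrite sqr_enorm (@le_trans _ _ (\sum_(i < d) r ^+ 2))//.
  by apply: ler_sum => i _; rewrite -real_normK ?num_real// ler_pXn2r ?nnegrE.
rewrite sumr_const card_ord exprMn -[leLHS]mulr_natl ler_wpM2r ?sqr_ge0//.
by rewrite -natrX ler_nat expnS expn1 leq_pmulr.
Qed.

(** Expand the nonnegative sum of the squares of |y| x_i - |x| y_i and divide by 2 |x| |y|. *)
Lemma sumr_mul_enorm x y : \sum_(i < d) x ord0 i * y ord0 i <= enorm x * enorm y.
Proof.
have [x0|x0] := eqVneq (enorm x) 0.
  rewrite x0 mul0r big1// => i _; move/eqP : x0; rewrite enorm_eq0 => /eqP ->.
  by rewrite mxE mul0r.
have [y0|y0] := eqVneq (enorm y) 0.
  rewrite y0 mulr0 big1// => i _; move/eqP : y0; rewrite enorm_eq0 => /eqP ->.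
  by rewrite mxE mulr0.
have xp : 0 < enorm x by rewrite lt_def x0 enorm_ge0.
have yp : 0 < enorm y by rewrite lt_def y0 enorm_ge0.
pose a := enorm x; pose b := enorm y.
have : 0 <= \sum_(i < d) (b * x ord0 i - a * y ord0 i) ^+ 2.
  by apply: sumr_ge0 => i _; exact: sqr_ge0.
rewrite (eq_bigr (fun i => b ^+ 2 * (x ord0 i ^+ 2) + a ^+ 2 * (y ord0 i ^+ 2)
  + (- (2 * a * b)) * (x ord0 i * y ord0 i))); last by move=> i _; ring.
rewrite !big_split/= -!mulr_sumr -!sqr_enorm -/a -/b => H.
rewrite -(ler_pM2l (x := 2 * a * b)) ?mulr_gt0//.
move: H; set S := \sum_(i < d) _ => H; lra.
Qed.

Lemma ler_enormD x y : enorm (x + y) <= enorm x + enorm y.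
Proof.
rewrite -(ler_pXn2r (n := 2))// ?nnegrE ?enorm_ge0 ?addr_ge0 ?enorm_ge0//.
rewrite sqr_enorm (eq_bigr (fun i => x ord0 i ^+ 2 + y ord0 i ^+ 2 +
  2 * (x ord0 i * y ord0 i))); last by move=> i _; rewrite mxE; ring.
rewrite !big_split/= -mulr_sumr -!sqr_enorm sqrrD.
have := sumr_mul_enorm x y; lra.
Qed.

Lemma ler_dist_enorm x y : `|enorm x - enorm y| <= enorm (x - y).
Proof.
rewrite ler_norml lerBlDr lerNl opprB lerBlDr; apply/andP; split.
  by rewrite -[in leRHS]enormN opprB -{1}(subrK x y) ler_enormD.
by rewrite -{1}(subrK y x) ler_enormD.
Qed.

End enorm_theory.

Section polar.
Variables (R : realType) (d : nat).
Local Notation rV := 'rV[R]_d.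
Local Notation L := (@lebesgue_rV R d).
Local Notation mu := (@lebesgue_measure R).

Lemma ge0_integral_scale (s : R) (f : R -> \bar R) :
  0 < s -> measurable_fun setT f -> (forall x, 0 <= f x)%E ->
  (\int[mu]_x f (s * x)%R = s^-1%:E * \int[mu]_x f x)%E.
Proof.
move=> s0 mf f0.
have mg : measurable_fun setT (fun x : measurableTypeR R => 0 + s * x : measurableTypeR R).
  by apply: measurable_funD => //; exact: measurable_funM.
have := @ge0_integral_pushforward _ _ _ _ _ _ mg mu setT f measurableT mf.
rewrite preimage_setT/= => H.
transitivity (\int[mu]_x (f \o (fun x : measurableTypeR R => (0 + s * x)%R)) x)%E.
  by apply: eq_integral => x _ /=; rewrite add0r.
rewrite -H//.
have sd0 : 0 <= s^-1 by rewrite invr_ge0 ltW.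
pose k : {nonneg R} := NngNum sd0.
rewrite (eq_measure_integral (mscale k mu)); last first.
  move=> A mA _.
  transitivity (s^-1%:E * (s%:E *
      mu ((fun x : measurableTypeR R => (0 + s * x)%R) @^-1` A)))%E.
    by rewrite muleA -EFinM mulVf ?mul1e// gt_eqF.
  by rewrite -lebesgue_measure_affine.
by rewrite ge0_integral_mscale.
Qed.

Let k (v : R) : R := \1_`[1, 2] v * v.

Let mk : measurable_fun setT k.
Proof. by apply: measurable_funM => //; exact: measurable_indic. Qed.

Let k_ge0 v : 0 <= k v.
Proof.
rewrite /k indicE mem_setE in_itv/=; 
have [/andP[v1 _]|_] := boolP (1 <= v <= 2); last by rewrite mul0r.
by rewrite mul1r; apply: le_trans v1.
Qed.

(** The restriction to s > 0 is a factor of the integrand, so that Tonelli and the scaling formula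
    apply on the whole line. *)
Definition halfline (s : R) : R := \1_`]0, +oo[ s.

Lemma measurable_halfline : measurable_fun setT halfline.
Proof. exact: measurable_indic. Qed.

Lemma halflineE s : halfline s = (0 < s)%R%:R.
Proof. by rewrite /halfline indicE mem_setE in_itv/= andbT. Qed.

Let int_k (r : R) : 0 < r -> (\int[mu]_s (halfline s * (k (r / s) / s))%:E = 1)%E.
Proof.
move=> r0.
have r2 : r / 2 < r by rewrite ltr_pdivrMr// mulr_natr mulr2n ltrDl.
(* The weight k(r / s) vanishes unless r / 2 <= s <= r, and there k(r / s) / s = r / s^2, with
   antiderivative - r / s and integral -1 + 2 = 1. *)
have := @continuous_FTC2 R (fun s => r * (s ^- 2)) (fun s => - (r * s^-1)) (r / 2) r r2.
have np (s : R) : r / 2 <= s -> s != 0.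
  by move=> rs; rewrite gt_eqF// (lt_le_trans _ rs)// divr_gt0.
have ci (s : R) : r / 2 <= s -> {for s, continuous (fun s : R => s^-1)}.
  by move=> /np s0; exact: inv_continuous.
rewrite (_ : (- (r * r^-1))%:E - (- (r * (r / 2)^-1))%:E = 1)%E; last first.
  by rewrite -EFinB; congr EFin; field; rewrite gt_eqF.
move=> FTC; rewrite -[RHS]FTC.
- rewrite [RHS]integral_mkcond; apply: eq_integral => s _.
  rewrite patchE mem_setE in_itv/= halflineE /k indicE mem_setE in_itv/=.
  have [s0|s0] := ltP 0 s; last first.
    by rewrite mul0r ifF// lt_geF//= (le_lt_trans s0)// divr_gt0.
  rewrite mul1r ler_pdivlMr// mul1r ler_pdivrMr// ler_pdivrMr// (mulrC s) andbC.
  case: (_ && _) => /=; last by rewrite !mul0r.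
  by congr EFin; field; rewrite gt_eqF.
- apply/subspace_continuousP => x /=; rewrite in_itv/= => /andP[xr _].
  apply: cvg_within_filter; apply: cvgM; first exact: cvg_cst.
  under eq_fun do rewrite -exprVn expr2.
  by rewrite -exprVn expr2; apply: cvgM; exact: ci.
- split.
  + move=> x; rewrite in_itv/= => /andP[/ltW/np xr _].
    by apply: derivableN; apply: derivableM => //; exact: derivableV.
  + apply: cvg_within_filter; apply: cvgN; apply: cvgM; first exact: cvg_cst.
    exact: ci.
  + apply: cvg_within_filter; apply: cvgN; apply: cvgM; first exact: cvg_cst.
    exact/ci/ltW.
- move=> x; rewrite in_itv/= => /andP[/ltW/np xr _].
  have dV := @derivableV _ _ (@id R) x 1 xr (@derivable_id _ _ _ _).
  rewrite derive1E deriveN; last by apply: derivableM.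
  rewrite deriveM//.
  rewrite derive_cst (@deriveV _ _ (@id R))// derive_id.
  by rewrite scaler0 addr0 /GRing.scale/= mulr1 mulrN opprK.
Qed.

Local Notation T := (measurableTypeR R).

Let mw : measurable_fun setT (fun p : rV * T => p.1).
Proof. exact: measurable_fst. Qed.

Let ms : measurable_fun setT (fun p : rV * T => p.2 : R).
Proof. exact: measurable_snd. Qed.

Let menorm d0 (X : measurableType d0) := @measurable_enorm _ X R d.

Let msV : measurable_fun setT (fun p : rV * T => (p.2 : R)^-1).
Proof. exact: (measurableT_comp (@measurable_invr R) ms). Qed.

(* The sphere is replaced by the shell 1 <= |y| <= 2: the weight k is chosen so
   that k(r / s) ds / s has total mass 1, and the formula follows from Tonelli
   and the scaling of Lebesgue measure. *)
Theorem ge0_integral_polar (G : rV -> R) : measurable_fun setT G ->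
  (forall x, 0 <= G x) -> G 0 = 0 ->
  (\int[L]_w (G w)%:E =
   \int[L]_y ((k (enorm y) / enorm y ^+ d)%:E *
     \int[mu]_s (halfline s * (s ^+ d / s) * G (s *: ((enorm y)^-1 *: y)))%:E))%E.
Proof.
move=> mG G0 Gz.
pose f (p : rV * T) : \bar R := (G p.1 * (halfline p.2 * (k (enorm p.1 / p.2) / p.2)))%:E.
have mf : measurable_fun setT f.
  apply/measurable_EFinP; apply: measurable_funM.
    exact: (measurableT_comp mG mw).
  apply: measurable_funM; first exact: (measurableT_comp measurable_halfline ms).
  apply: measurable_funM => //; apply: (measurableT_comp mk).
  by apply: measurable_funM => //; exact: menorm.
have f0 p : (0 <= f p)%E.
  rewrite lee_fin /f halflineE; have [p0|p0] := ltP 0 (p.2 : R); last by rewrite mul0r mulr0.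
  by rewrite mul1r mulr_ge0// divr_ge0// ltW.
transitivity (\int[L]_w \int[mu]_s f (w, s))%E.
  apply: eq_integral => w _; rewrite /f/=.
  under eq_integral do rewrite EFinM.
  rewrite ge0_integralZl_EFin//; last 2 first.
  - move=> s _; rewrite lee_fin halflineE; have [s0|s0] := ltP 0 s; last by rewrite mul0r.
    by rewrite mul1r divr_ge0// ltW.
  - apply/measurable_EFinP; apply: measurable_funM; first exact: measurable_halfline.
    apply: measurable_funM; last exact: measurable_invr.
    apply: (measurableT_comp mk); apply: measurable_funM => //.
    exact: measurable_invr.
  (* At w = 0 the inserted mass is 0 and not 1; [G 0 = 0] makes up for it. *)
  have [w0|w0] := eqVneq w 0; first by rewrite w0 Gz mul0e.
  rewrite int_k ?mule1// lt_def enorm_ge0 andbT enorm_eq0//.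
rewrite (@fubini_tonelli _ _ _ _ _ L mu f mf f0).
pose g (p : rV * T) : \bar R :=
  (halfline p.2 * (p.2 ^+ d / p.2) * k (enorm p.1) * G (p.2 *: p.1))%:E.
have mg : measurable_fun setT g.
  apply/measurable_EFinP; apply: measurable_funM; last first.
    by apply: (measurableT_comp mG); exact: measurable_rVZ.
  apply: measurable_funM; last by apply: (measurableT_comp mk); exact: menorm.
  apply: measurable_funM; first exact: (measurableT_comp measurable_halfline ms).
  by apply: measurable_funM => //; exact: measurable_funX.
have pd (s : R) : 0 <= halfline s * (s ^+ d / s).
  rewrite halflineE; have [s0|s0] := ltP 0 s; last by rewrite mul0r.
  by rewrite mul1r divr_ge0 ?exprn_ge0// ltW.
have g0 p : (0 <= g p)%E by rewrite lee_fin; apply: mulr_ge0 => //; apply: mulr_ge0.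
transitivity (\int[mu]_s \int[L]_y g (y, s))%E.
  apply: eq_integral => s _; rewrite /f /g/= halflineE.
  have [s0|s0] := ltP 0 (s : R); last first.
    by rewrite !integral0_eq// => x _; rewrite ?mul0r ?mulr0.
  pose h (w : rV) : \bar R := (s ^+ d * (G w * (k (enorm w / s) / s)))%:E.
  have mh : measurable_fun setT h.
    apply/measurable_EFinP; apply: measurable_funM => //; apply: measurable_funM => //.
    apply: measurable_funM => //; apply: (measurableT_comp mk).
    by apply: measurable_funM => //; exact: menorm.
  have h0 x : (0 <= h x)%E.
    rewrite lee_fin mulr_ge0 ?exprn_ge0 ?(ltW s0)// mulr_ge0// mulr_ge0//.
    by rewrite invr_ge0 ltW.
  rewrite [RHS](_ : _ = \int[L]_y h (0 + s *: y)%R)%E; last first.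
    apply: eq_integral => y _; rewrite /h add0r enormZ gtr0_norm//.
    congr EFin; rewrite [s * enorm y]mulrC mulfK ?gt_eqF// mul1r -!mulrA.
    by congr (_ * _); rewrite [LHS]mulrC (mulrA (\1__ _)) (mulrC _ (G _)) -!mulrA.
  rewrite ge0_integral_lebesgue_rV_affine// -ge0_integralZl_EFin//; last first.
    by rewrite invr_ge0 exprn_ge0// ltW.
  apply: eq_integral => w _; rewrite /h -EFinM; congr EFin.
  by rewrite mul1r mulKf// gt_eqF// exprn_gt0.
rewrite -(@fubini_tonelli _ _ _ _ _ L mu g mg g0).
apply: eq_integral => y _; rewrite /g/=.
have [y0|y0] := eqVneq (enorm y) 0.
  have k0 : k 0 = 0 by rewrite /k mulr0.
  by rewrite y0 k0 mul0r mul0e integral0_eq// => s _; rewrite mulr0 mul0r.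
have yp : 0 < enorm y by rewrite lt_def y0 enorm_ge0.
pose h (s : R) : \bar R := (halfline s * (s ^+ d / s) * G (s *: ((enorm y)^-1 *: y)))%:E.
have mh : measurable_fun setT h.
  apply/measurable_EFinP; apply: measurable_funM.
    apply: measurable_funM; first exact: measurable_halfline.
    by apply: measurable_funM; [exact: measurable_funX|exact: measurable_invr].
  by apply: (measurableT_comp mG); exact: measurable_rVZ.
have h0 s : (0 <= h s)%E by rewrite lee_fin mulr_ge0.
have Ky : 0 <= k (enorm y) / enorm y ^+ d * enorm y.
  apply: mulr_ge0; last exact: ltW.
  by apply: mulr_ge0 => //; rewrite invr_ge0 exprn_ge0// ltW.
(* The substitution replacing s by |y| s moves from the ray of y to that of the unit vector y / |y|.
   Its factor 1 / |y| meets the extra factor |y|, which comes from s^d / s, the form given to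
   s^(d-1). *)
transitivity ((k (enorm y) / enorm y ^+ d * enorm y)%:E * ((enorm y)^-1%:E *
   \int[mu]_s h s))%E; last first.
  by rewrite muleA -EFinM mulfK.
rewrite -(ge0_integral_scale yp mh h0) -ge0_integralZl_EFin//; last first.
  by apply: (measurableT_comp mh); exact: measurable_funM.
apply: eq_integral => s _; rewrite /h -EFinM; congr EFin.
rewrite !halflineE pmulr_rgt0// scalerA (mulrC (enorm y) s) mulfK//.
have [s0|s0] := ltP 0 (s : R); last by rewrite !mul0r mulr0.
rewrite !mul1r exprMn; field.
by rewrite y0 gt_eqF// expf_neq0.
Qed.
End polar.

(** * Tangent coordinates *)

Section gnomonic.
Variables (R : realType) (d : nat).
Local Notation rV := 'rV[R]_d.
Local Notation L := (@lebesgue_rV R d).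
Local Notation mu := (@lebesgue_measure R).

(* Inverse gnomonic projection: |gnomonic w| = atan |w|, in the direction of w
   (with value 0 at w = 0, where the division is by 0). *)
Definition gnomonic (w : rV) : rV := (atan (enorm w) / enorm w) *: w.

(** Jacobian at |x| = r of the inverse map, which sends x to (tan |x| / |x|) x: d - 1 angular
    factors tan r / r and the radial factor 1 + tan^2 r. The indicator reflects that [gnomonic]
    takes its values in the open ball of radius pi / 2. At r = 0 the value is 0, since division by 0
    gives 0, and not the limit 1. *)
Definition gnomonic_jacobian (r : R) : R :=
  \1_`]-oo, (pi / 2)[ r * ((tan r / r) ^+ d * (r / tan r) * (1 + tan r ^+ 2)).

Lemma measurable_gnomonic : measurable_fun setT gnomonic.
Proof.
apply: measurable_rVZ => //; apply: measurable_funM.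
  by apply: (measurableT_comp (@measurable_atanr R)); exact: measurable_enorm.
apply: (measurableT_comp (@measurable_invr R)); exact: measurable_enorm.
Qed.

Lemma measurable_gnomonic_jacobian : measurable_fun setT gnomonic_jacobian.
Proof.
have mt := @measurable_tanr R; have mi := @measurable_invr R.
apply: measurable_funM; first exact: measurable_indic.
apply: measurable_funM; last by apply: measurable_funD => //; exact: measurable_funX.
apply: measurable_funM.
  by apply: measurable_funX; apply: measurable_funM.
by apply: measurable_funM => //; exact: (measurableT_comp mi mt).
Qed.

Lemma atan_gt0 (x : R) : 0 < x -> 0 < atan x.
Proof. by rewrite -{2}atan0; exact: lt_atan. Qed.

Lemma tan_gt0 (x : R) : 0 < x -> x < pi / 2 -> 0 < tan x.
Proof.
move=> x0 xpi; rewrite -tan0 ltr_tan// in_itv/= ?xpi ?andbT.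
  by rewrite oppr_lt0 divr_gt0// pi_gt0.
by rewrite (lt_trans _ x0)// oppr_lt0 divr_gt0// pi_gt0.
Qed.

Lemma gnomonic_jacobian_ge0 r : 0 <= r -> 0 <= gnomonic_jacobian r.
Proof.
rewrite le_eqVlt => /predU1P[<-|r0].
  by rewrite /gnomonic_jacobian mul0r mulr0 mul0r mulr0.
rewrite /gnomonic_jacobian indicE mem_setE in_itv/=.
have [rp|_] := ltP r (pi / 2); last by rewrite mul0r.
have t0 := tan_gt0 r0 rp.
rewrite mul1r; apply: mulr_ge0; last by rewrite addr_ge0// sqr_ge0.
by rewrite mulr_ge0 ?exprn_ge0// divr_ge0// ltW.
Qed.

Lemma enorm_gnomonic w : enorm (gnomonic w) = atan (enorm w).
Proof.
rewrite enormZ ger0_norm; last first.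
  rewrite divr_ge0 ?enorm_ge0//; have := enorm_ge0 w.
  by rewrite le_eqVlt => /predU1P[<-|/atan_gt0/ltW//]; rewrite atan0.
have [->|w0] := eqVneq (enorm w) 0; first by rewrite mulr0 atan0.
by rewrite divfK.
Qed.

(** [gnomonic] preserves every ray from 0. In polar coordinates on both sides the claim therefore
    reduces, direction by direction, to the substitution by the tangent. *)
Theorem ge0_integral_gnomonic (f : rV -> R) : measurable_fun setT f ->
  (forall x, 0 <= f x) -> f 0 = 0 ->
  (\int[L]_w (f (gnomonic w))%:E =
   \int[L]_x (f x * gnomonic_jacobian (enorm x))%:E)%E.
Proof.
move=> mf f0 fz.
rewrite ge0_integral_polar//; last 2 first.
- exact: (measurableT_comp mf measurable_gnomonic).
- by rewrite /gnomonic scaler0.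
rewrite [RHS]ge0_integral_polar//; last 3 first.
- apply: measurable_funM => //.
  apply: (measurableT_comp measurable_gnomonic_jacobian).
  exact: measurable_enorm.
- by move=> x; rewrite mulr_ge0// gnomonic_jacobian_ge0// enorm_ge0.
- by rewrite fz mul0r.
apply: eq_integral => y _.
have [y0|y0] := eqVneq (enorm y) 0; first by rewrite y0 mulr0 mul0r !mul0e.
have yp : 0 < enorm y by rewrite lt_def y0 enorm_ge0.
congr (_ * _)%E; set u := _ *: y.
have u1 : enorm u = 1 by rewrite enormZ ger0_norm ?invr_ge0 ?ltW// mulVf.
pose G (s : R) : \bar R := (halfline s * (s ^+ d / s) * f (atan s *: u))%:E.
have mG : measurable_fun setT G.
  apply/measurable_EFinP; apply: measurable_funM.
    apply: measurable_funM; first exact: measurable_halfline.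
    by apply: measurable_funM; [exact: measurable_funX|exact: measurable_invr].
  by apply: (measurableT_comp mf); apply: measurable_rVZ => //; exact: measurable_atanr.
have G0 s : (0 <= G s)%E.
  rewrite lee_fin; apply: mulr_ge0 => //.
  rewrite halflineE; have [s0|s0] := ltP 0 (s : R); last by rewrite mul0r.
  by rewrite mul1r divr_ge0 ?exprn_ge0// ltW.
transitivity (\int[mu]_s G s)%E.
  apply: eq_integral => s _; rewrite /G; congr EFin; rewrite halflineE.
  have [s0|s0] := ltP 0 (s : R); last by rewrite !mul0r.
  by rewrite /gnomonic enormZ u1 gtr0_norm// mulr1 scalerA divfK// gt_eqF.
rewrite ge0_integral_tan// integral_mkcond.
apply: eq_integral => s _; rewrite patchE mem_setE in_itv/= /G.
rewrite enormZ u1 mulr1 halflineE.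
have pi20 : 0 < pi / 2 :> R by rewrite divr_gt0// pi_gt0.
case: ifPn => [/andP[s1 s2]|ns]; last first.
  have [s0|s0] := ltP 0 (s : R); last by rewrite halflineE ltNge s0 !mul0r.
  rewrite gtr0_norm// /gnomonic_jacobian indicE mem_setE in_itv/=.
  have -> : (s < pi / 2) = false.
    by apply: contraNF ns => ->; rewrite andbT (lt_trans _ s0)// oppr_lt0.
  by rewrite mul0r !mulr0.
have tani : s \in `](- (pi / 2)), (pi / 2)[ by rewrite in_itv/= s1 s2.
have zi : (0 : R) \in `](- (pi / 2)), (pi / 2)[ by rewrite in_itv/= pi20 oppr_lt0 pi20.
rewrite !halflineE tanK// -{1}tan0 ltr_tan//.
have [s0|s0] := ltP 0 (s : R); last by rewrite !mul0r mul0e.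
rewrite gtr0_norm// /gnomonic_jacobian indicE mem_setE in_itv/= s2 !mul1r -EFinM.
have t0 := tan_gt0 s0 s2; congr EFin.
have sd0 : s ^+ d != 0 by rewrite expf_neq0// gt_eqF.
rewrite [(tan s / s) ^+ d]expr_div_n; field.
by rewrite sd0 !gt_eqF.
Qed.
End gnomonic.

(** * Duality for the Hellinger-Kantorovich functional *)

Section entropy.
Variable R : realType.

Lemma entropyFE (s : R) : entropyF s = s * ln s - s + 1.
Proof.
by rewrite /entropyF; case: eqVneq => // ->; rewrite ln0// mul0r subrr add0r.
Qed.

(** Fenchel-Young inequality for F, from ln x <= x - 1 at x = u / s. *)
Lemma ge_entropyF (s u : R) : 0 <= s -> 0 < u -> 1 + s * ln u <= entropyF s + u.
Proof.
move=> + u0; rewrite le_eqVlt => /predU1P[<-|s0].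
  by rewrite /entropyF eqxx mul0r addr0 lerDl ltW.
have us : 0 < u / s by rewrite divr_gt0.
have : ln (u / s) <= u / s - 1.
  by rewrite -{1}(subrKC 1 (u / s)) le_ln1Dx// ltrBrDl subrr.
rewrite ln_div ?posrE// => H.
have : s * (ln u - ln s) <= s * (u / s - 1) by rewrite ler_pM2l.
rewrite entropyFE !mulrBr mulrCA divff ?gt_eqF//; lra.
Qed.

Lemma entropyF_ge0 (s : R) : 0 <= s -> 0 <= entropyF s.
Proof. by move=> s0; have := @ge_entropyF s 1 s0 ltr01; rewrite ln1; lra. Qed.

Lemma measurable_entropyF : measurable_fun setT (@entropyF R).
Proof.
rewrite (_ : @entropyF R = fun s => s * ln s - s + 1); last first.
  by apply/funext => s; exact: entropyFE.
apply: measurable_funD => //; apply: measurable_funB => //.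
by apply: measurable_funM => //; exact: measurable_ln.
Qed.

Lemma measurable_hk_cost : measurable_fun setT (@hk_cost R).
Proof.
apply: measurable_fun_ifT => //.
  exact: measurable_fun_ltr.
apply/measurable_EFinP; apply: measurableT_comp => //.
apply: (measurableT_comp (@measurable_ln R)); apply: measurable_funX.
exact: measurable_cosr.
Qed.

Lemma hk_cost_ge0 (r : R) : (0 <= hk_cost r)%E.
Proof.
rewrite /hk_cost; case: ifPn => // _; rewrite lee_fin oppr_ge0 ln_le0//.
Qed.
End entropy.

Lemma ge0_integral_marginal d1 d2 (X : measurableType d1)
    (Y : measurableType d2) (R : realType) (eta : {measure set X -> \bar R})
    (mu : {measure set Y -> \bar R}) (P : X -> Y) (sigma : Y -> R)
    (f : Y -> \bar R) :
  measurable_fun setT P -> measurable_fun setT sigma -> (forall y, 0 <= sigma y) ->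
  (forall A, measurable A ->
    eta (P @^-1` A) = (\int[mu]_(x in A) (sigma x)%:E)%E) ->
  measurable_fun setT f -> (forall y, 0 <= f y)%E ->
  (\int[eta]_z f (P z) = \int[mu]_x (f x * (sigma x)%:E))%E.
Proof.
move=> mP msig sig0 etaE mf f0.
have [n [nE nI]] := @weighted_image_measure _ _ _ _ R eta P (cst 1) mP
  (@measurable_cst _ _ _ _ _ _) (fun=> ler01).
rewrite -(@ge0_integral_density _ _ _ mu n sigma)//.
  rewrite nI//; apply: eq_integral => z _; by rewrite mule1.
move=> A mA; rewrite nE// -etaE//.
rewrite -[LHS]/(\int[eta]_(x in P @^-1` A) cst 1 x)%E integral_cst ?mul1e//.
by rewrite -[X in measurable X]setTI; exact: mP.
Qed.

Section hk_duality.
Variables (R : realType) (d : nat).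
Local Notation rV := 'rV[R]_d.
Local Notation fmeasure := {finite_measure set rV -> \bar R}.

(** One half of weak duality, for either marginal: [ge_entropyF] at s = sigma(x) is integrated
    against mu, and the term sigma ln u turns into an integral against eta because sigma is the
    marginal density. *)
Let marginal_bound (eta : {finite_measure set (rV * rV)%type -> \bar R})
    (mu : fmeasure) (P : rV * rV -> rV) (sigma u : rV -> R) (C : R) :
  measurable_fun setT P -> is_density sigma ->
  (forall A, measurable A ->
    eta (P @^-1` A) = (\int[mu]_(x in A) (sigma x)%:E)%E) ->
  measurable_fun setT u -> (forall x, 0 < u x) -> 0 <= C ->
  (forall x, 0 <= ln (u x) + C) ->
  (mu setT + \int[eta]_z (ln (u (P z)) + C)%:E <=
   \int[mu]_x (entropyF (sigma x))%:E + \int[mu]_x (u x)%:E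
   + C%:E * eta setT)%E.
Proof.
move=> mP [msig sig0] etaE mu0 u0 C0 uC.
have mlnu : measurable_fun setT (fun x => ln (u x) + C).
  apply: measurable_funD => //; exact: (measurableT_comp (@measurable_ln R)).
have mF : measurable_fun setT (fun x => entropyF (sigma x)).
  exact: (measurableT_comp (@measurable_entropyF R)).
rewrite (@ge0_integral_marginal _ _ _ _ _ eta mu P sigma
  (fun x => (ln (u x) + C)%:E))//; last exact/measurable_EFinP.
have -> : (C%:E * eta setT = \int[mu]_x (C * sigma x)%:E)%E.
  rewrite -(preimage_setT P) etaE// -ge0_integralZl_EFin//.
  - by move=> x _; rewrite lee_fin.
  - exact/measurable_EFinP.
have -> : mu setT = (\int[mu]_x 1%:E)%E by rewrite integral_cst// mul1e.
rewrite -ge0_integralD//; last first.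
- apply: emeasurable_funM; exact/measurable_EFinP.
- by move=> x _; rewrite mule_ge0 ?lee_fin.
rewrite -ge0_integralD//; last 4 first.
- by move=> x _; rewrite lee_fin entropyF_ge0.
- exact/measurable_EFinP.
- by move=> x _; rewrite lee_fin ltW.
- exact/measurable_EFinP.
rewrite -ge0_integralD//; last 4 first.
- by move=> x _; rewrite adde_ge0// lee_fin ?entropyF_ge0// ltW.
- by apply: emeasurable_funD; exact/measurable_EFinP.
- by move=> x _; rewrite lee_fin mulr_ge0.
- by apply/measurable_EFinP; exact: measurable_funM.
apply: ge0_le_integral => //.
- by move=> x _; rewrite adde_ge0// mule_ge0// lee_fin.
- apply: emeasurable_funD => //; apply: emeasurable_funM; exact/measurable_EFinP.
- apply: emeasurable_funD.
    by apply: emeasurable_funD; exact/measurable_EFinP.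
  by apply/measurable_EFinP; exact: measurable_funM.
- move=> x _; rewrite -EFinM -!EFinD lee_fin.
  by have := ge_entropyF (sig0 x) (u0 x); lra.
Qed.

(* The constant C only serves to keep all the integrands nonnegative. *)
Theorem hk_dual_bound (mu0 mu1 : fmeasure)
    (eta : {finite_measure set (rV * rV)%type -> \bar R})
    (sigma0 sigma1 u0 u1 : rV -> R) (C : R) :
  hk_plan mu0 mu1 eta sigma0 sigma1 ->
  measurable_fun setT u0 -> measurable_fun setT u1 ->
  (forall x, 0 < u0 x) -> (forall x, 0 < u1 x) -> 0 <= C ->
  (forall x, 0 <= ln (u0 x) + C) -> (forall x, 0 <= ln (u1 x) + C) ->
  (forall x y, enorm (x - y) < pi / 2 ->
    cos (enorm (x - y)) ^+ 2 <= u0 x * u1 y) ->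
  (mu0 setT + mu1 setT <= hk_functional mu0 mu1 eta sigma0 sigma1
    + (\int[mu0]_x (u0 x)%:E + \int[mu1]_x (u1 x)%:E))%E.
Proof.
move=> [s0 s1 eta0 eta1] mu0' mu1' u00 u10 C0 uC0 uC1 ucos.
have e0 (A : set rV) : measurable A ->
    eta (@fst rV rV @^-1` A) = (\int[mu0]_(x in A) (sigma0 x)%:E)%E.
  by move=> mA; rewrite -eta0//; congr (eta _); apply/seteqP; split => [z|z []].
have e1 (A : set rV) : measurable A ->
    eta (@snd rV rV @^-1` A) = (\int[mu1]_(x in A) (sigma1 x)%:E)%E.
  by move=> mA; rewrite -eta1//; congr (eta _); apply/seteqP; split => [z|z []].
have H0 := marginal_bound measurable_fst s0 e0 mu0' u00 C0 uC0.
have H1 := marginal_bound measurable_snd s1 e1 mu1' u10 C0 uC1.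
have mln u : measurable_fun setT u -> measurable_fun setT (fun x : rV => (ln (u x) + C)%:E).
  move=> mu; apply/measurable_EFinP; apply: measurable_funD => //.
  exact: (measurableT_comp (@measurable_ln R)).
have mc : measurable_fun setT (fun z : rV * rV => hk_cost (enorm (z.1 - z.2))).
  apply: (measurableT_comp (@measurable_hk_cost R)); apply: measurable_enorm.
  apply: measurable_rVD => //; exact: measurable_rVN.
(* The constraint on u0 and u1 says that ln u0 + ln u1 plus the cost is nonnegative, trivially so
   where the cost is infinite. This is integrated with 2 C added to both sides. *)
have H2 : (C%:E * eta setT + C%:E * eta setT <=
   \int[eta]_z (ln (u0 z.1) + C)%:E + \int[eta]_z (ln (u1 z.2) + C)%:E +
   \int[eta]_z hk_cost (enorm (z.1 - z.2)))%E.
  have m0 : measurable_fun setT (fun z : rV * rV => (ln (u0 z.1) + C)%:E).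
    exact: (measurableT_comp (mln _ mu0') measurable_fst).
  have m1 : measurable_fun setT (fun z : rV * rV => (ln (u1 z.2) + C)%:E).
    exact: (measurableT_comp (mln _ mu1') measurable_snd).
  rewrite -ge0_integralD//; [|by move=> z _; rewrite lee_fin..].
  rewrite -ge0_integralD//; last 3 first.
  - by move=> z _; rewrite adde_ge0// lee_fin.
  - exact: emeasurable_funD.
  - by move=> z _; exact: hk_cost_ge0.
  rewrite -ge0_muleDl; [|by rewrite lee_fin..].
  rewrite -EFinD -integral_cst//; apply: ge0_le_integral => //.
  - by move=> z _; rewrite lee_fin addr_ge0.
  - by apply: emeasurable_funD => //; exact: emeasurable_funD.
  - move=> z _; rewrite /hk_cost; case: ifPn => [zpi|_]; last first.
      by rewrite addey ?leey// -EFinD.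
    rewrite -!EFinD lee_fin.
    have cp : 0 < cos (enorm (z.1 - z.2)).
      rewrite cos_gt0_pihalf// zpi andbT (lt_le_trans _ (enorm_ge0 _))//.
      by rewrite oppr_lt0 divr_gt0// pi_gt0.
    have : ln (cos (enorm (z.1 - z.2)) ^+ 2) <= ln (u0 z.1 * u1 z.2).
      by rewrite ler_ln ?posrE ?exprn_gt0 ?mulr_gt0// ucos.
    by rewrite lnM ?posrE//; lra.
move: H0 H1 H2; rewrite /hk_functional.
have : (0 <= \int[eta]_z (ln (u0 z.1) + C)%:E)%E.
  by apply: integral_ge0 => z _; rewrite lee_fin.
have : (0 <= \int[eta]_z (ln (u1 z.2) + C)%:E)%E.
  by apply: integral_ge0 => z _; rewrite lee_fin.
have : (0 <= \int[eta]_z hk_cost (enorm (z.1 - z.2)))%E.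
  by apply: integral_ge0 => z _; exact: hk_cost_ge0.
have : (0 <= \int[mu0]_x (entropyF (sigma0 x))%:E)%E.
  by apply: integral_ge0 => x _; rewrite lee_fin entropyF_ge0// s0.2.
have : (0 <= \int[mu1]_x (entropyF (sigma1 x))%:E)%E.
  by apply: integral_ge0 => x _; rewrite lee_fin entropyF_ge0// s1.2.
have : (0 <= \int[mu0]_x (u0 x)%:E)%E by apply: integral_ge0 => x _; rewrite lee_fin ltW.
have : (0 <= \int[mu1]_x (u1 x)%:E)%E by apply: integral_ge0 => x _; rewrite lee_fin ltW.
have : (C%:E * eta setT)%E \is a fin_num by rewrite fin_numM// fin_num_measure.
have : mu0 setT \is a fin_num by rewrite fin_num_measure.
have : mu1 setT \is a fin_num by rewrite fin_num_measure.
move: (\int[eta]_z (ln (u0 z.1) + C)%:E)%E (\int[eta]_z (ln (u1 z.2) + C)%:E)%E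
 (\int[eta]_z hk_cost _)%E (\int[mu0]_x (entropyF _)%:E)%E
 (\int[mu1]_x (entropyF _)%:E)%E (\int[mu0]_x (u0 x)%:E)%E (\int[mu1]_x (u1 x)%:E)%E
 (C%:E * eta setT)%E (mu0 setT) (mu1 setT).
(* The masses and C eta(setT) are finite, hence can be cancelled. If one of the seven remaining
   integrals is infinite, the hypotheses force the right-hand side to be +oo. *)
move=> I0 I1 K F0 F1 U0 U1 e m0 m1 /fineK <- /fineK <- /fineK <-.
move: I0 I1 K F0 F1 U0 U1.
move=> [I0| |] [I1| |] [K| |] [F0| |] [F1| |] [U0| |] [U1| |]//=; rewrite ?leey//.
by rewrite -!EFinD !lee_fin; lra.
Qed.
End hk_duality.

(** * Linear motions of the cone *)

Section trigo_facts.
Variable R : realType.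

Lemma sqr_cos_atan (v : R) : cos (atan v) ^+ 2 = (1 + v ^+ 2)^-1.
Proof.
by rewrite cos_atan exprVn sqr_sqrtr// addr_ge0// sqr_ge0.
Qed.

Lemma sqr_sin_atan (v : R) : sin (atan v) ^+ 2 = v ^+ 2 / (1 + v ^+ 2).
Proof.
have v0 : 1 + v ^+ 2 != 0 by rewrite gt_eqF// ltr_pwDl// sqr_ge0.
by rewrite sin2cos2 sqr_cos_atan; field.
Qed.

Lemma sin_atan_cos (v : R) : sin (atan v) = v * cos (atan v).
Proof.
by rewrite -{2}(atanK v) /tan divfK// cos_atan invr_eq0 sqrtr_eq0 -ltNge ltr_pwDl// sqr_ge0.
Qed.

Lemma sqr_cos_atanB (v w : R) : cos (atan v - atan w) ^+ 2 =
  (1 + v * w) ^+ 2 / ((1 + v ^+ 2) * (1 + w ^+ 2)).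
Proof.
rewrite cosB !sin_atan_cos.
rewrite (_ : _ + _ = cos (atan v) * cos (atan w) * (1 + v * w)); last by ring.
by rewrite 2!exprMn !sqr_cos_atan invfM mulrC.
Qed.

Lemma atan_ge0 (v : R) : 0 <= v -> 0 <= atan v.
Proof. by move=> v0; rewrite -(atan0 R) le_atan. Qed.

(** Keeps the plan constructed below in the finite branch of [hk_cost]. *)
Lemma dist_atan_lt (v w : R) : 0 <= v -> 0 <= w -> `|atan v - atan w| < pi / 2.
Proof.
move=> v0 w0; rewrite ltr_norml.
have := atan_ge0 v0; have := atan_ge0 w0.
have := atan_ltpi2 v; have := atan_ltpi2 w; lra.
Qed.

End trigo_facts.

Section cone_pushforward.
Variables (R : realType) (d : nat) (x0 : 'rV[R]_d).
Local Notation rV := 'rV[R]_d.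
Local Notation L := (@lebesgue_rV R d).

(* (g, r |y|) are the coordinates of the displaced cone vector in the half-plane
   of y: its squared length is cone_mass, its angle is |cone_pos - x0|. *)
Definition cone_pos (g r : R) (y : rV) : rV := x0 + gnomonic ((r / g) *: y).

Definition cone_mass (g r : R) (y : rV) : R := g ^+ 2 + r ^+ 2 * enorm y ^+ 2.

Lemma measurable_cone_pos g r : measurable_fun setT (cone_pos g r).
Proof.
apply: measurable_rVD => //; apply: (measurableT_comp (@measurable_gnomonic R d)).
exact: measurable_rVZ.
Qed.

Lemma cone_mass_ge0 g r y : 0 <= cone_mass g r y.
Proof. by apply: addr_ge0; rewrite ?sqr_ge0// mulr_ge0// sqr_ge0. Qed.

Lemma enorm_cone_pos g r y : 0 < g -> 0 < r ->
  enorm (cone_pos g r y - x0) = atan (r / g * enorm y).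
Proof.
move=> g0 r0; rewrite /cone_pos addrC addKr enorm_gnomonic enormZ gtr0_norm//.
by rewrite divr_gt0.
Qed.

Lemma gnomonicZ (a : R) (y : rV) : 0 < a ->
  gnomonic (a *: y) = (atan (a * enorm y) / enorm y) *: y.
Proof.
move=> a0; rewrite /gnomonic enormZ gtr0_norm// scalerA; congr (_ *: _).
by rewrite invfM [a^-1 * _]mulrC mulrA divfK// gt_eqF.
Qed.

(** Both positions lie on the ray from x0 in direction y, so the bound of | |x - x0| - |y - x0| | by
    |x - y|, which loses something in general, is an equality here. *)
Lemma enorm_cone_posB g0 r0 g1 r1 y : 0 < g0 -> 0 < r0 -> 0 < g1 -> 0 < r1 ->
  enorm (cone_pos g0 r0 y - cone_pos g1 r1 y) =
  `|atan (r0 / g0 * enorm y) - atan (r1 / g1 * enorm y)|.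
Proof.
move=> g00 r00 g10 r10; rewrite /cone_pos opprD addrACA subrr add0r.
rewrite !gnomonicZ ?divr_gt0// -scalerBl enormZ -mulrBl normrM normfV.
rewrite (ger0_norm (enorm_ge0 y)).
have [->|y0] := eqVneq (enorm y) 0; last by rewrite divfK.
by rewrite !mulr0 atan0 subrr normr0.
Qed.

(* Quadratic form of diag(g1 / g0, r1 / r0) at the unit vector of angle |x - x0|.
   It is also the density of the marginal of the optimal plan. *)
Definition cone_potential (g0 r0 g1 r1 : R) (x : rV) : R :=
  g1 / g0 * cos (enorm (x - x0)) ^+ 2 + r1 / r0 * sin (enorm (x - x0)) ^+ 2.

Section potential.
Variables (g0 r0 g1 r1 : R).
Hypotheses (g0p : 0 < g0) (r0p : 0 < r0) (g1p : 0 < g1) (r1p : 0 < r1).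

Lemma measurable_cone_potential : measurable_fun setT (cone_potential g0 r0 g1 r1).
Proof.
have me : measurable_fun setT (fun x : rV => enorm (x - x0)).
  by apply: measurable_enorm; exact: measurable_rVD.
apply: measurable_funD; apply: measurable_funM => //; apply: measurable_funX.
  exact: (measurableT_comp (@measurable_cosr R)).
exact: (measurableT_comp (@measurable_sinr R)).
Qed.

Lemma cone_potential_ge x :
  Num.min (g1 / g0) (r1 / r0) <= cone_potential g0 r0 g1 r1 x.
Proof.
set k := Num.min _ _; rewrite /cone_potential; set c := cos _; set s := sin _.
rewrite -[k]mulr1 -(cos2Dsin2 (enorm (x - x0))) mulrDr.
by apply: lerD; rewrite ler_wpM2r ?sqr_ge0// /k ge_min lexx ?orbT.
Qed.

Lemma cone_potential_gt0 x : 0 < cone_potential g0 r0 g1 r1 x.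
Proof.
by apply: lt_le_trans (cone_potential_ge x); rewrite lt_min !divr_gt0.
Qed.

(** With v_i = (g_i, r_i |y|), the map diag(g1 / g0, r1 / r0) sends v_0 to v_1. Its quadratic form
    at the unit vector v_0 / |v_0| is thus the inner product of v_0 and v_1 over |v_0|^2, where
    |v_0|^2 is [cone_mass]. *)
Lemma cone_potential_pos y :
  cone_potential g0 r0 g1 r1 (cone_pos g0 r0 y) * cone_mass g0 r0 y =
  g0 * g1 + r0 * r1 * enorm y ^+ 2.
Proof.
rewrite /cone_potential enorm_cone_pos// sqr_cos_atan sqr_sin_atan /cone_mass.
set n := enorm y.
field; rewrite (gt_eqF g0p) (gt_eqF r0p) andbT /=.
by rewrite gt_eqF// ltr_pwDl ?exprn_gt0// sqr_ge0.
Qed.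

(* Cauchy-Schwarz in the half-plane, after replacing |x - y| by the difference
   of the distances to x0. *)
Lemma cone_potentialM x y : enorm (x - y) < pi / 2 ->
  cos (enorm (x - y)) ^+ 2 <=
  cone_potential g0 r0 g1 r1 x * cone_potential g1 r1 g0 r0 y.
Proof.
move=> xy; set a := enorm (x - x0); set b := enorm (y - x0).
have ab : `|a - b| <= enorm (x - y).
  by apply: le_trans (ler_dist_enorm _ _) _; rewrite opprB addrA subrK.
have pi0 := pi_gt0 R.
have c1 : cos (enorm (x - y)) <= cos (a - b).
  rewrite -(cos_norm (a - b)).
  move: ab; rewrite le_eqVlt => /predU1P[->//|ab].
  apply/ltW; rewrite ltr_cos// in_itv/=.
    by rewrite normr_ge0/= (le_trans (ltW ab))// (le_trans (ltW xy))//; lra.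
  by rewrite enorm_ge0/= (le_trans (ltW xy))//; lra.
have c0 : 0 <= cos (enorm (x - y)).
  by rewrite cos_ge0_pihalf// (ltW xy) andbT; have := enorm_ge0 (x - y); lra.
apply: (@le_trans _ _ (cos (a - b) ^+ 2)).
  by rewrite ler_pXn2r ?nnegrE// (le_trans c0).
rewrite cosB /cone_potential -/a -/b.
move: (cos a) (sin a) (cos b) (sin b) => p q p' q'.
rewrite -subr_ge0.
rewrite (_ : _ - _ = (p * q' * g1 * r0 - q * p' * r1 * g0) ^+ 2 / (g0 * g1 * r0 * r1)).
  by rewrite divr_ge0 ?sqr_ge0// !mulr_ge0// ltW.
by field; rewrite !gt_eqF.
Qed.

End potential.
End cone_pushforward.

(** * Exact distance between two displacements of the same weight *)

Section cone_distance.
Variables (R : realType) (d : nat) (x0 : 'rV[R]_d) (b : 'rV[R]_d -> R).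
Local Notation rV := 'rV[R]_d.
Local Notation L := (@lebesgue_rV R d).
Local Notation fmeasure := {finite_measure set rV -> \bar R}.
Hypotheses (mb : measurable_fun setT b) (b0 : forall y, 0 <= b y).
Hypothesis bfin : (\int[L]_y (b y * (1 + enorm y ^+ 2))%:E < +oo)%E.

(** For the fields of cone vectors v_i(y) = (g_i, r_i |y|) and the measure b(y) dy, this is the
    squared norm of v_0 at (g0^2, r0^2), the inner product of v_0 and v_1 at (g0 g1, r0 r1), and
    their squared L^2 distance at ((g1 - g0)^2, (r1 - r0)^2). *)
Definition moment (A B : R) : \bar R :=
  (\int[L]_y (b y * (A + B * enorm y ^+ 2))%:E)%E.

Lemma measurable_moment A B :
  measurable_fun setT (fun y => b y * (A + B * enorm y ^+ 2)).
Proof.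
apply: measurable_funM => //; apply: measurable_funD => //.
by apply: measurable_funM => //; apply: measurable_funX; exact: measurable_enorm.
Qed.

Lemma moment_integrand_ge0 A B y : 0 <= A -> 0 <= B ->
  0 <= b y * (A + B * enorm y ^+ 2).
Proof. by move=> A0 B0; rewrite mulr_ge0// addr_ge0// mulr_ge0// sqr_ge0. Qed.

Lemma moment_fin_num A B : 0 <= A -> 0 <= B -> moment A B \is a fin_num.
Proof.
move=> A0 B0; rewrite ge0_fin_numE; last first.
  by apply: integral_ge0 => y _; rewrite lee_fin moment_integrand_ge0.
have m1 : measurable_fun setT (fun y => (b y * (1 + enorm y ^+ 2))%:E).
  have := measurable_moment 1 1; under eq_fun do rewrite mul1r.
  by move=> ?; exact/measurable_EFinP.
apply: (@le_lt_trans _ _ (\int[L]_y ((A + B)%:E * (b y * (1 + enorm y ^+ 2))%:E))%E).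
  apply: ge0_le_integral => //.
  - by move=> y _; rewrite lee_fin moment_integrand_ge0.
  - by apply/measurable_EFinP; exact: measurable_moment.
  - exact: emeasurable_funM.
  - move=> y _; rewrite -EFinM lee_fin [leRHS]mulrCA ler_wpM2l//.
    have := sqr_ge0 (enorm y); set n := _ ^+ 2 => n0; nra.
rewrite ge0_integralZl_EFin//; last 2 first.
  by move=> y _; rewrite lee_fin mulr_ge0// addr_ge0// sqr_ge0.
  by rewrite addr_ge0.
by rewrite lte_mul_pinfty// lee_fin addr_ge0.
Qed.

Lemma momentD A B A' B' : 0 <= A -> 0 <= B -> 0 <= A' -> 0 <= B' ->
  (moment A B + moment A' B' = moment (A + A') (B + B'))%E.
Proof.
move=> A0 B0 A'0 B'0; rewrite -ge0_integralD//.
- by apply: eq_integral => y _; rewrite -EFinD; congr EFin; ring.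
- by move=> y _; rewrite lee_fin moment_integrand_ge0.
- by apply/measurable_EFinP; exact: measurable_moment.
- by move=> y _; rewrite lee_fin moment_integrand_ge0.
- by apply/measurable_EFinP; exact: measurable_moment.
Qed.

Definition cone_pushforward (g r : R) (nu : fmeasure) :=
  (forall A, measurable A -> nu A =
     (\int[L]_(y in cone_pos x0 g r @^-1` A) (b y * cone_mass g r y)%:E)%E) /\
  (forall f : rV -> \bar R, measurable_fun setT f -> (forall x, 0 <= f x)%E ->
     (\int[nu]_x f x =
      \int[L]_y (f (cone_pos x0 g r y) * (b y * cone_mass g r y)%:E))%E).

Lemma cone_pushforward_exists g r : exists nu, cone_pushforward g r nu.
Proof.
apply: finite_weighted_image_measure.
- exact: measurable_cone_pos.
- exact: measurable_moment.
- by move=> y; rewrite mulr_ge0// cone_mass_ge0.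
- have := @moment_fin_num (g ^+ 2) (r ^+ 2) (sqr_ge0 _) (sqr_ge0 _).
  by move/fin_numPlt/andP => -[].
Qed.

Section pair.
Variables (g0 r0 g1 r1 : R) (nu0 nu1 : fmeasure).
Hypotheses (g0p : 0 < g0) (r0p : 0 < r0) (g1p : 0 < g1) (r1p : 0 < r1).
Hypotheses (nu0P : cone_pushforward g0 r0 nu0) (nu1P : cone_pushforward g1 r1 nu1).

Let u0 := cone_potential x0 g0 r0 g1 r1.
Let u1 := cone_potential x0 g1 r1 g0 r0.
Let P0 := cone_pos x0 g0 r0.
Let P1 := cone_pos x0 g1 r1.

Lemma cone_pushforward_setT g r nu : cone_pushforward g r nu ->
  nu setT = moment (g ^+ 2) (r ^+ 2).
Proof. by move=> [-> //]; rewrite preimage_setT. Qed.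

Let potential_moment0 : (\int[nu0]_x (u0 x)%:E = moment (g0 * g1) (r0 * r1))%E.
Proof.
rewrite nu0P.2; last 2 first.
- by apply/measurable_EFinP; exact: measurable_cone_potential.
- by move=> x; rewrite lee_fin ltW// cone_potential_gt0.
apply: eq_integral => y _; rewrite -EFinM mulrCA cone_potential_pos//.
Qed.

Let potential_moment1 : (\int[nu1]_x (u1 x)%:E = moment (g0 * g1) (r0 * r1))%E.
Proof.
rewrite nu1P.2; last 2 first.
- by apply/measurable_EFinP; exact: measurable_cone_potential.
- by move=> x; rewrite lee_fin ltW// cone_potential_gt0.
apply: eq_integral => y _; rewrite -EFinM mulrCA cone_potential_pos//.
by rewrite (mulrC g1) (mulrC r1).
Qed.

(** The total masses are the squared norms of v_0 and v_1, and each potential integrates to their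
    inner product. Weak duality then becomes the expansion of |v_1 - v_0|^2. *)
Let cone_hk_lower eta s0 s1 : hk_plan nu0 nu1 eta s0 s1 ->
  (moment ((g1 - g0) ^+ 2) ((r1 - r0) ^+ 2) <= hk_functional nu0 nu1 eta s0 s1)%E.
Proof.
move=> plan.
have minp (x y z w : R) : 0 < x -> 0 < y -> 0 < z -> 0 < w ->
    0 < Num.min (x / y) (z / w).
  by move=> *; rewrite lt_min !divr_gt0.
(* Smallest eigenvalues of the two quadratic forms, hence positive lower bounds of the potentials; C
   is chosen so that ln u + C >= 0 for both. *)
pose k0 := Num.min (g1 / g0) (r1 / r0); pose k1 := Num.min (g0 / g1) (r0 / r1).
have k0p : 0 < k0 by exact: minp.
have k1p : 0 < k1 by exact: minp.
pose C := `|ln k0| + `|ln k1|.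
have C0 : `|ln k0| <= C by rewrite lerDl.
have C1 : `|ln k1| <= C by rewrite lerDr.
have lnC k u : 0 < k -> k <= u -> `|ln k| <= C -> 0 <= ln u + C.
  move=> kp ku kC.
  have : ln k <= ln u by rewrite ler_ln// posrE// (lt_le_trans kp).
  by have := ler_norm (- ln k); rewrite normrN; lra.
have := @hk_dual_bound R d nu0 nu1 eta s0 s1 u0 u1 C plan.
rewrite potential_moment0 potential_moment1.
rewrite (cone_pushforward_setT nu0P) (cone_pushforward_setT nu1P).
have gg0 : 0 <= g0 * g1 by rewrite mulr_ge0// ltW.
have rr0 : 0 <= r0 * r1 by rewrite mulr_ge0// ltW.
rewrite (momentD gg0 rr0 gg0 rr0) momentD ?sqr_ge0//.
rewrite (_ : g0 ^+ 2 + g1 ^+ 2 = (g1 - g0) ^+ 2 + (g0 * g1 + g0 * g1)); last by ring.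
rewrite (_ : r0 ^+ 2 + r1 ^+ 2 = (r1 - r0) ^+ 2 + (r0 * r1 + r0 * r1)); last by ring.
have gg : 0 <= g0 * g1 + g0 * g1 by rewrite addr_ge0.
have rr : 0 <= r0 * r1 + r0 * r1 by rewrite addr_ge0.
have e : (moment ((g1 - g0) ^+ 2 + (g0 * g1 + g0 * g1))
    ((r1 - r0) ^+ 2 + (r0 * r1 + r0 * r1)) =
  moment ((g1 - g0) ^+ 2) ((r1 - r0) ^+ 2) +
  moment (g0 * g1 + g0 * g1) (r0 * r1 + r0 * r1))%E.
  by rewrite momentD ?sqr_ge0.
rewrite e leeD2rE ?moment_fin_num//; apply.
- exact: measurable_cone_potential.
- exact: measurable_cone_potential.
- exact: cone_potential_gt0.
- exact: cone_potential_gt0.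
- by rewrite addr_ge0.
- by move=> x; apply: lnC C0 => //; exact: cone_potential_ge.
- by move=> x; apply: lnC C1 => //; exact: cone_potential_ge.
- by move=> x y; exact: cone_potentialM.
Qed.

(** Here cos^2 = u0 u1, so equality holds in the dual constraint. As u0 q0 = u1 q1 =: W for the
    masses q0 and q1, the logarithms cancel and q0 + q1 - 2 W remains, which is |v_1 - v_0|^2. *)
Let cone_hk_integrand y :
  ((entropyF (u0 (P0 y)))%:E * (b y * cone_mass g0 r0 y)%:E +
   (entropyF (u1 (P1 y)))%:E * (b y * cone_mass g1 r1 y)%:E +
   hk_cost (enorm (P0 y - P1 y)) * (b y * (g0 * g1 + r0 * r1 * enorm y ^+ 2))%:E =
   (b y * ((g1 - g0) ^+ 2 + (r1 - r0) ^+ 2 * enorm y ^+ 2))%:E)%E.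
Proof.
set n := enorm y; have n0 : 0 <= n := enorm_ge0 y.
have q0p : 0 < cone_mass g0 r0 y.
  by rewrite ltr_pwDl ?exprn_gt0// mulr_ge0// sqr_ge0.
have q1p : 0 < cone_mass g1 r1 y.
  by rewrite ltr_pwDl ?exprn_gt0// mulr_ge0// sqr_ge0.
have W0 : u0 (P0 y) * cone_mass g0 r0 y = g0 * g1 + r0 * r1 * n ^+ 2.
  exact: cone_potential_pos.
have W1 : u1 (P1 y) * cone_mass g1 r1 y = g0 * g1 + r0 * r1 * n ^+ 2.
  by rewrite cone_potential_pos// (mulrC g1) (mulrC r1).
have u0p : 0 < u0 (P0 y) by exact: cone_potential_gt0.
have u1p : 0 < u1 (P1 y) by exact: cone_potential_gt0.
have cosE : cos (enorm (P0 y - P1 y)) ^+ 2 = u0 (P0 y) * u1 (P1 y).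
  rewrite enorm_cone_posB// cos_norm sqr_cos_atanB.
  have -> : u0 (P0 y) = (g0 * g1 + r0 * r1 * n ^+ 2) / cone_mass g0 r0 y.
    by rewrite -W0 mulfK// gt_eqF.
  have -> : u1 (P1 y) = (g0 * g1 + r0 * r1 * n ^+ 2) / cone_mass g1 r1 y.
    by rewrite -W1 mulfK// gt_eqF.
  have m0 : cone_mass g0 r0 y != 0 by rewrite gt_eqF.
  have m1 : cone_mass g1 r1 y != 0 by rewrite gt_eqF.
  move: m0 m1; rewrite /cone_mass -/n => m0 m1.
  by field; rewrite !exprMn m0 m1 (gt_eqF g0p) (gt_eqF g1p).
rewrite /hk_cost ifT; last first.
  by rewrite enorm_cone_posB// dist_atan_lt// mulr_ge0// divr_ge0// ltW.
rewrite cosE lnM ?posrE// -!EFinM -!EFinD; congr EFin.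
rewrite !entropyFE -W0.
move: W1; rewrite -W0 => W1.
have mE : (g1 - g0) ^+ 2 + (r1 - r0) ^+ 2 * n ^+ 2 =
    cone_mass g0 r0 y + cone_mass g1 r1 y - 2 * (u0 (P0 y) * cone_mass g0 r0 y).
  by rewrite W0 /cone_mass -/n; ring.
rewrite mE; move: W1.
move: (u0 _) (u1 _) (ln _) (ln _) (cone_mass g0 r0 y) (cone_mass g1 r1 y) (b y).
move=> a c lc la p q B W1.
transitivity (B * (a * p * la + (c * q) * lc - a * p - c * q + p + q
  - (la + lc) * (a * p))); first by ring.
by rewrite W1; ring.
Qed.

(** The plan couples the two positions of each y, with weight b(y) times the inner product of the
    two cone vectors; by [cone_potential_pos] its marginal densities are u0 and u1. *)
Let cone_hk_upper : exists eta s0 s1, hk_plan nu0 nu1 eta s0 s1 /\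
  moment ((g1 - g0) ^+ 2) ((r1 - r0) ^+ 2) = hk_functional nu0 nu1 eta s0 s1.
Proof.
pose w y := b y * (g0 * g1 + r0 * r1 * enorm y ^+ 2).
have gg : 0 <= g0 * g1 by rewrite mulr_ge0// ltW.
have rr : 0 <= r0 * r1 by rewrite mulr_ge0// ltW.
have mw : measurable_fun setT w by exact: measurable_moment.
have w0 y : 0 <= w y by exact: moment_integrand_ge0.
have mP : measurable_fun setT (fun y => (P0 y, P1 y)).
  by apply/measurable_fun_pairP; split; exact: measurable_cone_pos.
have wfin : (\int[L]_y (w y)%:E < +oo)%E.
  by have /fin_numPlt/andP[] := moment_fin_num gg rr.
have [eta [etaE etaI]] := finite_weighted_image_measure mP mw w0 wfin.
have mu0 : measurable_fun setT u0 by exact: measurable_cone_potential.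
have mu1 : measurable_fun setT u1 by exact: measurable_cone_potential.
have pu0 x : 0 < u0 x by exact: cone_potential_gt0.
have pu1 x : 0 < u1 x by exact: cone_potential_gt0.
have marg (A : set rV) (nu : fmeasure) (u : rV -> R) g r :
    measurable A -> measurable_fun setT u -> (forall x, 0 < u x) ->
    cone_pushforward g r nu ->
    (forall y, u (cone_pos x0 g r y) * cone_mass g r y = g0 * g1 + r0 * r1 * enorm y ^+ 2) ->
    (\int[nu]_(x in A) (u x)%:E = \int[L]_(y in cone_pos x0 g r @^-1` A) (w y)%:E)%E.
  move=> mA mu up nuP uE; rewrite integral_mkcond nuP.2.
  - rewrite [RHS]integral_mkcond; apply: eq_integral => y _.
    rewrite !patchE (_ : (y \in _ @^-1` A) = (cone_pos x0 g r y \in A)) ?inE//.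
    case: ifPn => _; last by rewrite mul0e.
    by rewrite -EFinM mulrCA uE.
  - apply/(measurable_restrictT _ _).1 => //; apply: measurable_funTS.
    exact/measurable_EFinP.
  - by move=> x; rewrite patchE; case: ifPn => // _; rewrite lee_fin ltW.
exists eta, u0, u1; split.
  split.
  - by split => // x; exact: ltW.
  - by split => // x; exact: ltW.
  - move=> A mA; rewrite (marg A nu0 u0 g0 r0)//; last by move=> y; exact: cone_potential_pos.
    rewrite etaE; last exact: measurableX.
    by congr (\int[L]_(y in _) _)%E; apply/seteqP; split => [y []|y].
  - move=> A mA; rewrite (marg A nu1 u1 g1 r1)//; last first.
      by move=> y; rewrite cone_potential_pos// (mulrC g1) (mulrC r1).
    rewrite etaE; last exact: measurableX.
    by congr (\int[L]_(y in _) _)%E; apply/seteqP; split => [y []|y].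
have mc : measurable_fun setT (fun z : rV * rV => hk_cost (enorm (z.1 - z.2))).
  apply: (measurableT_comp (@measurable_hk_cost R)); apply: measurable_enorm.
  by apply: measurable_rVD => //; exact: measurable_rVN.
have mF (u : rV -> R) : measurable_fun setT u ->
    measurable_fun setT (fun x : rV => (entropyF (u x))%:E).
  move=> mu; apply/measurable_EFinP. exact: (measurableT_comp (@measurable_entropyF R) mu).
have F0 (u : rV -> R) (x : rV) : 0 < u x -> (0 <= (entropyF (u x) : R)%:E)%E.
  by move=> up; rewrite lee_fin entropyF_ge0// ltW.
rewrite /hk_functional etaI//; last by move=> z; exact: hk_cost_ge0.
rewrite nu0P.2; [|exact: mF|by move=> x; exact: F0].
rewrite nu1P.2; [|exact: mF|by move=> x; exact: F0].
have mm g r : measurable_fun setT (fun y => (b y * cone_mass g r y)%:E).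
  by apply/measurable_EFinP; exact: measurable_moment.
have mp g r : measurable_fun setT (cone_pos x0 g r) by exact: measurable_cone_pos.
have pm g r y : (0 <= (b y * cone_mass g r y)%:E)%E.
  by rewrite lee_fin mulr_ge0// cone_mass_ge0.
have mi0 : measurable_fun setT (fun y =>
    (entropyF (u0 (P0 y)))%:E * (b y * cone_mass g0 r0 y)%:E)%E.
  by apply: emeasurable_funM => //; exact: (measurableT_comp (mF _ mu0) (mp _ _)).
have mi1 : measurable_fun setT (fun y =>
    (entropyF (u1 (P1 y)))%:E * (b y * cone_mass g1 r1 y)%:E)%E.
  by apply: emeasurable_funM => //; exact: (measurableT_comp (mF _ mu1) (mp _ _)).
rewrite -ge0_integralD//; last 2 first.
- by move=> y _; rewrite mule_ge0// F0.
- by move=> y _; rewrite mule_ge0// F0.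
rewrite -ge0_integralD//; last 4 first.
- by move=> y _; rewrite adde_ge0// mule_ge0// F0.
- exact: emeasurable_funD.
- by move=> y _; rewrite mule_ge0 ?hk_cost_ge0// lee_fin.
- apply: emeasurable_funM; last exact/measurable_EFinP.
  exact: (measurableT_comp mc mP).
by apply: eq_integral => y _; rewrite cone_hk_integrand.
Qed.

(** HK is here the L^2 distance of the two fields of cone vectors. This makes the speed constant
    when g and r are affine in time. *)
Theorem HK_cone_pushforward :
  HK nu0 nu1 = Num.sqrt (fine (moment ((g1 - g0) ^+ 2) ((r1 - r0) ^+ 2))).
Proof.
congr (Num.sqrt (fine _)); apply/eqP; rewrite eq_le; apply/andP; split.
  by apply: ereal_inf_lbound; have [eta [s0 [s1 H]]] := cone_hk_upper; exists eta, s0, s1.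
by apply: le_ereal_inf_tmp => _ [eta [s0 [s1 [H ->]]]]; exact: cone_hk_lower.
Qed.

End pair.
End cone_distance.

(** * Density of the displaced weight and its bounds *)

Section atan_bounds.
Variable R : realType.

(** Mean value theorem: atan t = t / (1 + c^2) for some c between 0 and t. *)
Lemma atan_bounds (t : R) : 0 < t -> t / (1 + t ^+ 2) <= atan t <= t.
Proof.
move=> t0.
have dat (x : R) : is_derive x 1 (@atan R) (1 + x ^+ 2)^-1 by exact: is_derive1_atan.
have cat : {within `[0, t], continuous (@atan R)}.
  by apply: continuous_subspaceT => x; exact: continuous_atan.
have [c] := MVT t0 (fun x _ => dat x) cat.
rewrite in_itv/= atan0 !subr0 => /andP[c0 ct] ->.
have c1 : 0 < 1 + c ^+ 2 by rewrite ltr_pwDl// sqr_ge0.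
have t1 : 0 < 1 + t ^+ 2 by rewrite ltr_pwDl// sqr_ge0.
have ct2 : c ^+ 2 <= t ^+ 2 by rewrite ler_pXn2r ?nnegrE// ltW.
apply/andP; split.
  by rewrite mulrC ler_pM2r// lef_pV2 ?posrE// lerD2l.
by rewrite ger_pMl// invf_le1// lerDl sqr_ge0.
Qed.

(* Ratio of the density at angle rho to its value as rho -> 0. *)
Definition cone_distortion (d : nat) (rho : R) : R :=
  (1 + tan rho ^+ 2) ^+ 2 * (tan rho / rho) ^+ d.-1.

(** The exponent counts [d.-1] factors tan rho / rho, each between 1 and 1 + tan^2 rho by
    [atan_bounds], and two factors 1 + tan^2 rho. *)
Lemma cone_distortion_bounds d (rho T : R) : 0 < rho -> rho < pi / 2 ->
  tan rho <= T -> 1 <= cone_distortion d rho <= (1 + T ^+ 2) ^+ (d.-1 + 2).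
Proof.
move=> r0 rpi tT; have t0 := tan_gt0 r0 rpi.
have rE : atan (tan rho) = rho.
  by rewrite tanK// in_itv/= rpi andbT (lt_trans _ r0)// oppr_lt0 divr_gt0// pi_gt0.
have := atan_bounds t0; rewrite rE; set t := tan rho in t0 tT * => /andP[rl ru].
have t1 : 0 < 1 + t ^+ 2 by rewrite ltr_pwDl// sqr_ge0.
have q1 : 1 <= t / rho by rewrite ler_pdivlMr// mul1r.
have q2 : t / rho <= 1 + t ^+ 2.
  by rewrite ler_pdivrMr// mulrC -ler_pdivrMr.
have tt : 1 + t ^+ 2 <= 1 + T ^+ 2.
  by rewrite lerD2l ler_pXn2r ?nnegrE// ?(le_trans (ltW t0))// ltW.
have q0 : 0 <= t / rho by apply: le_trans q1.
have T1 : 0 <= 1 + T ^+ 2 by rewrite (le_trans _ tt)// ltW.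
rewrite /cone_distortion -/t; apply/andP; split.
  rewrite -[leLHS]mul1r; apply: ler_pM => //; last exact: exprn_ege1.
  by apply: exprn_ege1; rewrite lerDl sqr_ge0.
rewrite exprD mulrC; apply: ler_pM; rewrite ?exprn_ge0 ?(ltW t1)//.
  by rewrite lerXn2r ?nnegrE// (le_trans q2).
by rewrite lerXn2r ?nnegrE// ltW.
Qed.
End atan_bounds.

Section cone_density.
Variables (R : realType) (d : nat) (x0 : 'rV[R]_d) (m D : R).
Local Notation rV := 'rV[R]_d.
Local Notation L := (@lebesgue_rV R d).
Local Notation fmeasure := {finite_measure set rV -> \bar R}.
Hypotheses (d0 : (0 < d)%N) (m0 : 0 < m) (D0 : 0 < D).

(** The ball is punctured so that the integrands vanish at the origin, as the polar and gnomonic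
    formulas require. *)
Definition ball_weight (y : rV) : R := m * \1_`]0, D[ (enorm y).

Lemma measurable_ball_weight : measurable_fun setT ball_weight.
Proof.
apply: measurable_funM => //.
apply: (@measurableT_comp _ _ _ _ _ _ (\1_`]0, D[ : R -> R)).
  exact: measurable_indic.
exact: measurable_enorm.
Qed.

Lemma ball_weight_ge0 y : 0 <= ball_weight y.
Proof. by rewrite mulr_ge0 ?(ltW m0)// indicE. Qed.

Lemma ball_weightE y : ball_weight y = if 0 < enorm y < D then m else 0.
Proof.
rewrite /ball_weight indicE mem_setE in_itv/=.
by case: (_ < _ < _); rewrite ?mulr1 ?mulr0.
Qed.

Lemma ball_weight_fin :
  (\int[L]_y (ball_weight y * (1 + enorm y ^+ 2))%:E < +oo)%E.
Proof.
pose B : set rV := [set v | forall i, `[-D, D]%classic (v ord0 i)].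
have mB : measurable B.
  rewrite (_ : B = \bigcap_(i : 'I_d) ((fun v : rV => v ord0 i) @^-1` `[-D, D])).
    apply: fin_bigcap_measurable => // i _.
    rewrite -[X in measurable X]setTI; exact: measurable_rV_coord.
  by apply/seteqP; split=> v Bv i; [move=> _|]; exact: Bv.
have LB : (L B < +oo)%E.
  have -> : (L B = \prod_(i < d) lebesgue_measure `[(- D)%R, D])%E.
    by apply: (@lebesgue_rV_box R d (fun=> `[- D, D]%classic)) => i.
  rewrite (eq_bigr (fun=> (D + D)%:E)); last first.
    move=> i _; rewrite lebesgue_measure_itv/= lte_fin ifT; last by rewrite gtrN.
    by rewrite -EFinD opprK.
  by rewrite prodEFin ltry.
apply: (@le_lt_trans _ _ (\int[L]_(y in B) (m * (1 + D ^+ 2))%:E)%E).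
  rewrite [leRHS]integral_mkcond; apply: ge0_le_integral => //.
  - by move=> y _; rewrite lee_fin mulr_ge0 ?ball_weight_ge0// addr_ge0// sqr_ge0.
  - apply/measurable_EFinP; apply: measurable_funM; first exact: measurable_ball_weight.
    by apply: measurable_funD => //; apply: measurable_funX; exact: measurable_enorm.
  - exact/(measurable_restrictT _ _).1.
  - move=> y _; rewrite patchE ball_weightE.
    case: ifPn => [/andP[y0 yD]|_]; last first.
      rewrite mul0r; case: ifPn => // _; rewrite lee_fin mulr_ge0 ?(ltW m0)//.
      by rewrite addr_ge0// sqr_ge0.
    rewrite mem_set.
      by rewrite lee_fin ler_pM2l// lerD2l ler_pXn2r ?nnegrE ?enorm_ge0// ltW.
    move=> i /=; rewrite in_itv/= -ler_norml (le_trans (ler_coord_enorm _ _))// ltW//.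
by rewrite integral_cst// lte_mul_pinfty// lee_fin mulr_ge0 ?(ltW m0)// addr_ge0// sqr_ge0.
Qed.

Lemma ball_weight_gt0 : (0 < \int[L]_y (ball_weight y)%:E)%E.
Proof.
(* The cube [a, 2a]^d avoids 0 and lies in the ball of radius D, since its points have norm at most
   d * 2a = D / 2. *)
pose a := D / (4 * d%:R).
have dR : 0 < d%:R :> R by rewrite ltr0n.
have a0 : 0 < a by rewrite divr_gt0// mulr_gt0.
pose B : set rV := [set v | forall i, `[a, 2 * a]%classic (v ord0 i)].
have mB : measurable B.
  rewrite (_ : B = \bigcap_(i : 'I_d) ((fun v : rV => v ord0 i) @^-1` `[a, 2 * a])).
    apply: fin_bigcap_measurable => // i _.
    rewrite -[X in measurable X]setTI; exact: measurable_rV_coord.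
  by apply/seteqP; split=> v Bv i; [move=> _|]; exact: Bv.
have LB : (0 < L B)%E.
  have -> : (L B = \prod_(i < d) lebesgue_measure `[a, (2 * a)%R])%E.
    by apply: (@lebesgue_rV_box R d (fun=> `[a, 2 * a]%classic)) => i.
  rewrite (eq_bigr (fun=> a%:E)); last first.
    move=> i _; rewrite lebesgue_measure_itv/= lte_fin ifT; last by lra.
    by rewrite -EFinD; congr EFin; lra.
  by rewrite prodEFin lte_fin prodr_gt0.
apply: (@lt_le_trans _ _ (\int[L]_(y in B) m%:E)%E).
  by rewrite integral_cst// mule_gt0.
rewrite integral_mkcond; apply: ge0_le_integral => //.
- by move=> y _; rewrite patchE; case: ifPn => // _; rewrite lee_fin ltW.
- exact/(measurable_restrictT _ _).1.
- by apply/measurable_EFinP; exact: measurable_ball_weight.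
- move=> y _; rewrite patchE; case: ifPn => [|_]; last by rewrite lee_fin ball_weight_ge0.
  rewrite inE => By; rewrite ball_weightE ifT//; apply/andP; split.
    apply: lt_le_trans (ler_coord_enorm y (Ordinal d0)).
    have := By (Ordinal d0); rewrite /= in_itv/= => /andP[ay _].
    by rewrite (lt_le_trans a0)// (le_trans ay)// ler_norm.
  apply: (@le_lt_trans _ _ (d%:R * (2 * a))).
    apply: enorm_le_coord => // i; have := By i; rewrite /= in_itv/= => /andP[ay ya].
    by rewrite ger0_norm// (le_trans (ltW a0)).
  rewrite (_ : d%:R * (2 * a) = D / 2); last by rewrite /a; field; rewrite gt_eqF.
  by rewrite ltr_pdivrMr// ltr_pMr// ltr1n.
Qed.

End cone_density.

Section cone_density.
Variables (R : realType) (d : nat) (x0 : 'rV[R]_d) (m D g r : R).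
Local Notation rV := 'rV[R]_d.
Local Notation L := (@lebesgue_rV R d).
Local Notation fmeasure := {finite_measure set rV -> \bar R}.
Hypotheses (d0 : (0 < d)%N) (m0 : 0 < m) (D0 : 0 < D) (g0 : 0 < g) (r0 : 0 < r).

(** With tan |x - x0| = (r / g) |y|, the factors are the Jacobian of the dilation by r / g, the
    weight at y, the mass g^2 + r^2 |y|^2 = g^2 (1 + tan^2 |x - x0|), and the Jacobian of
    [gnomonic]. *)
Definition cone_density (x : rV) : R :=
  (r / g) ^- d * (m * \1_`]0, D[ (tan (enorm (x - x0)) / (r / g)) *
    (g ^+ 2 * (1 + tan (enorm (x - x0)) ^+ 2)) *
    gnomonic_jacobian d (enorm (x - x0))).

Let rg0 : 0 < r / g. Proof. by rewrite divr_gt0. Qed.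

Let profile (z : rV) : R :=
  m * \1_`]0, D[ (tan (enorm z) / (r / g)) * (g ^+ 2 * (1 + tan (enorm z) ^+ 2)).

Let mtan d1 (X : measurableType d1) (f : X -> rV) : measurable_fun setT f ->
  measurable_fun setT (fun x => tan (enorm (f x))).
Proof.
by move=> mf; apply: (measurableT_comp (@measurable_tanr R)); exact: measurable_enorm.
Qed.

Let mprofile d1 (X : measurableType d1) (f : X -> rV) : measurable_fun setT f ->
  measurable_fun setT (fun x => profile (f x)).
Proof.
move=> mf; apply: measurable_funM.
  apply: measurable_funM => //.
  apply: (@measurableT_comp _ _ _ _ _ _ (\1_`]0, D[ : R -> R)).
    exact: measurable_indic.
  by apply: measurable_funM => //; exact: mtan.
apply: measurable_funM => //; apply: measurable_funD => //.
by apply: measurable_funX; exact: mtan.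
Qed.

Let profile_ge0 z : 0 <= profile z.
Proof.
by rewrite /profile !mulr_ge0 ?(ltW m0) ?(ltW g0) ?addr_ge0 ?sqr_ge0// indicE.
Qed.

Lemma measurable_cone_density : measurable_fun setT cone_density.
Proof.
have mx : measurable_fun setT (fun x : rV => x - x0) by exact: measurable_rVD.
apply: measurable_funM => //; apply: measurable_funM; first exact: mprofile.
apply: (measurableT_comp (@measurable_gnomonic_jacobian R d)).
exact: measurable_enorm.
Qed.

Lemma cone_density_ge0 x : 0 <= cone_density x.
Proof.
rewrite mulr_ge0 ?invr_ge0 ?exprn_ge0 ?(ltW rg0)//.
by rewrite mulr_ge0 ?gnomonic_jacobian_ge0 ?enorm_ge0//; exact: profile_ge0.
Qed.

(** [cone_pos] is a dilation, then [gnomonic], then a translation; the three change of variables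
    formulas are applied in turn. *)
Lemma cone_pushforward_density (nu : fmeasure) (A : set rV) :
  cone_pushforward x0 (ball_weight m D) g r nu -> measurable A ->
  nu A = (\int[L]_(x in A) (cone_density x)%:E)%E.
Proof.
move=> [nuE _] mA; rewrite nuE// [LHS]integral_mkcond.
pose f z : R := \1_A (x0 + z) * profile z.
have mx0 : measurable_fun setT (fun z : rV => x0 + z) by exact: measurable_rVD.
have mf : measurable_fun setT f.
  apply: measurable_funM; last exact: mprofile.
  by apply: (@measurableT_comp _ _ _ _ _ _ (\1_A : rV -> R)).
have f0 z : 0 <= f z by rewrite mulr_ge0// indicE.
have fz : f 0 = 0.
  rewrite /f /profile (_ : enorm 0 = 0); last by apply/eqP; rewrite enorm_eq0.
  have i0 : \1_`]0, D[ 0 = 0 :> R by rewrite indicE mem_setE in_itv/= ltxx.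
  by rewrite tan0 mul0r i0 mulr0 mul0r mulr0.
have mfg : measurable_fun setT (f \o @gnomonic R d).
  exact: (measurableT_comp mf (@measurable_gnomonic R d)).
transitivity (\int[L]_y (f (gnomonic (0 + (r / g) *: y)%R))%:E)%E.
  apply: eq_integral => y _; rewrite patchE add0r /f indicE /cone_pos.
  rewrite (_ : (y \in _ @^-1` A) = (x0 + gnomonic ((r / g) *: y) \in A)) ?inE//.
  case: ifPn => _; last by rewrite mul0r.
  rewrite mul1r /profile enorm_gnomonic atanK enormZ gtr0_norm//.
  congr EFin; rewrite /ball_weight /cone_mass.
  rewrite [_ * enorm y]mulrC mulfK ?gt_eqF//; congr (_ * _).
  by field; rewrite gt_eqF.
rewrite (@ge0_integral_lebesgue_rV_affine R d _ 0
  (fun w => (f (gnomonic w))%:E))//; last 2 first.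
- exact/measurable_EFinP.
- by move=> w; rewrite lee_fin.
rewrite ge0_integral_gnomonic//.
pose h (x : rV) : \bar R := (\1_A x * cone_density x)%:E.
have mh : measurable_fun setT h.
  apply/measurable_EFinP; apply: measurable_funM => //.
  exact: measurable_cone_density.
have h0 x : (0 <= h x)%E by rewrite lee_fin mulr_ge0 ?cone_density_ge0// indicE.
rewrite -ge0_integralZl_EFin//; last 3 first.
- by move=> z _; rewrite lee_fin mulr_ge0 ?gnomonic_jacobian_ge0 ?enorm_ge0.
- apply/measurable_EFinP; apply: measurable_funM => //.
  apply: (measurableT_comp (@measurable_gnomonic_jacobian R d)).
  exact: measurable_enorm.
- by rewrite invr_ge0 exprn_ge0 ?ltW.
transitivity (\int[L]_x h (x0 + 1 *: x)%R)%E.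
  apply: eq_integral => z _; rewrite /h scale1r /cone_density [x0 + z]addrC addrK.
  by rewrite -EFinM /f /profile [z + x0]addrC; congr EFin; ring.
rewrite (ge0_integral_lebesgue_rV_affine x0 ltr01 mh h0) expr1n invr1 mul1e.
rewrite [RHS]integral_mkcond; apply: eq_integral => x _; rewrite patchE /h indicE.
by case: ifPn => _; rewrite ?mul1r ?mul0r.
Qed.

(** The constants combine as (g / r)^d g^2 = g^(d+2) / r^d. Of the two factors 1 + tan^2 in
    [cone_distortion], one comes from the mass and one from the radial derivative. *)
Lemma cone_densityE x : cone_density x =
  if (0 < enorm (x - x0) < pi / 2) && (tan (enorm (x - x0)) < D * (r / g)) then
    m * (g ^+ (d + 2) / r ^+ d) * cone_distortion d (enorm (x - x0)) else 0.
Proof.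
rewrite /cone_density; set rho := enorm _; have rho0 : 0 <= rho := enorm_ge0 _.
rewrite /gnomonic_jacobian !indicE !mem_setE !in_itv/= ltr_pdivrMr//.
have [rpi|rpi] := ltP rho (pi / 2); last first.
  by rewrite andbF !(mul0r, mulr0).
have := rho0; rewrite le_eqVlt => /predU1P[<-|rp].
  by rewrite tan0 mul0r ltxx/= !(mulr0, mul0r).
have t0 := tan_gt0 rp rpi.
rewrite rp/= divr_gt0//=; case: ifPn => _; last by rewrite !(mulr0, mul0r).
rewrite /cone_distortion; set t := tan rho in t0 *.
have -> : (t / rho) ^+ d * (rho / t) = (t / rho) ^+ d.-1.
  by rewrite -{1}(prednK d0) exprS; field; rewrite !gt_eqF.
rewrite expr_div_n invf_div exprD mulr1 mul1r; field.
by rewrite expf_neq0// gt_eqF.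
Qed.

Lemma cone_density_bounds x T : D * (r / g) <= T ->
  m * (1 + T ^+ 2) ^+ (d.-1 + 2) <= 1 ->
  cone_density x = 0 \/
  m * (g ^+ (d + 2) / r ^+ d) <= cone_density x <= g ^+ (d + 2) / r ^+ d.
Proof.
move=> DT mT; rewrite cone_densityE; set rho := enorm _.
case: ifPn => [/andP[/andP[r00 rpi] tT]|_]; last by left.
right; have /andP[t1 t2] := @cone_distortion_bounds R d rho T r00 rpi (le_trans (ltW tT) DT).
have c0 : 0 < g ^+ (d + 2) / r ^+ d by rewrite divr_gt0// exprn_gt0.
apply/andP; split; first by rewrite ler_pMr// mulr_gt0.
by rewrite mulrAC ger_pMl// (le_trans _ mT)// ler_pM2l.
Qed.

End cone_density.

(** The integrand E(c(x)) may change sign and be infinite, so positive and negative parts are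
    compared separately instead of assuming integrability. *)
Lemma le_integral_measurable d0 (X : measurableType d0) (R : realType)
    (mu : {measure set X -> \bar R}) (D : set X) (f g : X -> \bar R) :
  measurable D -> measurable_fun D f -> measurable_fun D g ->
  (forall x, D x -> f x <= g x)%E ->
  (\int[mu]_(x in D) f x <= \int[mu]_(x in D) g x)%E.
Proof.
move=> mD mf mg fg; rewrite integralE [leRHS]integralE.
have fgD : {in D, forall x, (f x <= g x)%E} by move=> x /set_mem; exact: fg.
apply: leeB; apply: ge0_le_integral => //.
- exact: measurable_funepos.
- exact: measurable_funepos.
- by move=> x /mem_set; exact: funepos_le.
- exact: measurable_funeneg.
- exact: measurable_funeneg.
- by move=> x /mem_set; exact: funeneg_le.
Qed.

(** * Energy of absolutely continuous measures *)

Section convex_density.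
Variables (R : realType) (E : R -> \bar R).
Hypotheses (Econv : econvex_on (V := R^o) `[0, +oo[ E) (E0 : E 0 = 0%E).

Lemma ge0_itv (c : R) : 0 <= c -> `[0, +oo[%classic c.
Proof. by move=> c0; rewrite /= in_itv/= c0. Qed.

Lemma itv_ge0 (c : R) : `[0, +oo[%classic c -> 0 <= c.
Proof. by rewrite /= in_itv/= andbT. Qed.

(** Monotonicity of E(c) / c in a form without division, which also covers infinite values. *)
Lemma convex_scale_le (t c : R) : 0 <= t <= 1 -> 0 <= c ->
  (E (t * c) <= t%:E * E c)%E.
Proof.
move=> t01 c0; have := Econv.2 _ _ t (ge0_itv (lexx 0)) (ge0_itv c0) t01.
by rewrite E0 mule0 add0e scaler0 add0r.
Qed.

(** By convexity every sublevel set is an interval. *)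
Lemma measurable_convex_ge0 : measurable_fun (`[0, +oo[%classic : set R) E.
Proof.
apply: (measurability _ (ErealGenOInfty.measurableE R)).
move=> _ [_ [x ->] <-].
rewrite [X in measurable X](_ : _ =
  (`[0, +oo[%classic : set R) `\` (`[0, +oo[%classic `&` [set c | (E c <= x%:E)%E])).
  apply: measurableD => //; apply: is_interval_measurable.
  move=> a b [a0 Ea] [b0 Eb] z /andP[az zb].
  move: a0 b0 => /itv_ge0 a0 /itv_ge0 b0.
  have z0 : 0 <= z by exact: le_trans az.
  split; first exact: ge0_itv.
  have [ab|ab] := eqVneq a b.
    have za : z = a by apply/eqP; rewrite eq_le az andbT ab.
    by rewrite za.
  have ba : 0 < b - a by rewrite subr_gt0 lt_neqAle ab (le_trans az).
  pose t := (z - a) / (b - a).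
  have t01 : 0 <= t <= 1.
    rewrite /t divr_ge0 ?subr_ge0 ?(le_trans az)//= ler_pdivrMr// mul1r; lra.
  have := Econv.2 _ _ t (ge0_itv a0) (ge0_itv b0) t01.
  rewrite (_ : (1 - t) *: (a : R^o) + t *: (b : R^o) = z :> R); last first.
    by rewrite /t /GRing.scale/=; field; rewrite gt_eqF.
  move/le_trans; apply.
  have /andP[t0 t1] := t01.
  apply: (@le_trans _ _ ((1 - t)%:E * x%:E + t%:E * x%:E)%E).
    by apply: leeD; apply: lee_wpmul2l => //; rewrite lee_fin// subr_ge0.
  by rewrite -!EFinM -EFinD lee_fin; lra.
apply/seteqP; split => [c [c0 Ec]|c [c0 Ec]].
  split => // -[_ /= cx]; move: Ec; rewrite /= in_itv/= andbT.
  by rewrite ltNge cx.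
split => //; rewrite /= in_itv/= andbT ltNge; apply/negP => cx.
by apply: Ec; split.
Qed.

Section rV.
Variables (d : nat) (Omega : set 'rV[R]_d).
Hypothesis mOmega : measurable Omega.
Local Notation rV := 'rV[R]_d.
Local Notation L := (@lebesgue_rV R d).
Local Notation fmeasure := {finite_measure set rV -> \bar R}.

Definition has_density (nu : fmeasure) (c : rV -> R) :=
  is_density c /\
  forall A, measurable A -> nu A = (\int[L]_(x in A) (c x)%:E)%E.

Lemma measurable_convex_density (c : rV -> R) : is_density c ->
  measurable_fun Omega (fun x => E (c x)).
Proof.
move=> [mc c0]; apply: measurable_funTS.
apply: (measurable_comp _ _ measurable_convex_ge0 mc) => //.
by move=> _ [x _ <-]; exact: ge0_itv.
Qed.

(** Since [energy] selects a value with [get], the value must be shown to exist and to be unique.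
    Uniqueness: the singular part is bounded by nu, which gives no mass to the Lebesgue-null set N,
    so it vanishes, and then the density agrees with c almost everywhere. *)
Lemma energy_density (nu : fmeasure) (c : rV -> R) : has_density nu c ->
  energy Omega E nu = (\int[L]_(x in Omega) E (c x))%E.
Proof.
move=> [dc nuc]; have [mc c0] := dc.
rewrite /energy; set S := [set v : \bar R | _].
have intc : L.-integrable setT (EFin \o c).
  apply/integrableP; split; first exact/measurable_EFinP.
  rewrite (eq_integral (EFin \o c)); last by move=> x _ /=; rewrite ger0_norm.
  by rewrite -nuc// -ge0_fin_numE// fin_num_measure.
have ScE v : S v -> v = (\int[L]_(x in Omega) E (c x))%E.
  move=> [c' [mup [[dc' nuc' [N [mN LN mupN]]] ->]]].
  have [mc' c'0] := dc'.
  have nuN : nu N = 0%E.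
    rewrite nuc//; apply: (null_set_integral mN _ LN).
    by apply/measurable_EFinP; exact: measurable_funTS.
  have mupN0 : mup N = 0%E.
    apply/eqP; rewrite eq_le measure_ge0 andbT -nuN nuc'// leeDr//.
    by apply: integral_ge0 => x _; rewrite lee_fin.
  have mup0 A : measurable A -> mup A = 0%E.
    move=> mA; apply/eqP; rewrite eq_le measure_ge0 andbT.
    apply: (@le_trans _ _ (mup (N `|` ~` N))).
      by apply: le_measure; rewrite ?inE// setUv.
    apply: le_trans (measureU2 mup mN (measurableC mN)) _.
    by rewrite [X in (X + _)%E]mupN0 [X in (_ + X)%E]mupN adde0.
  rewrite mup0// mule0 adde0; apply: ae_eq_integral => //.
  - exact: measurable_convex_density.
  - exact: measurable_convex_density.
  - have : ae_eq L setT (EFin \o c) (EFin \o c').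
      apply: integral_ae_eq => //; first exact/measurable_EFinP.
      by move=> A _ mA; rewrite -nuc// nuc'// mup0// adde0.
    apply: filterS => x /= H Ox; have := H I; by case=> ->.
apply: ScE; apply: getPex.
(* Existence: the zero measure, as Lebesgue measure with weight 0, serves as the singular part. *)
have [z [zE _]] := @finite_weighted_image_measure _ _ rV rV R L id (cst 0)
  (@measurable_id _ _ _) (@measurable_cst _ _ _ _ _ _) (fun=> lexx 0)
  ltac:(by rewrite integral0_eq// => x _; rewrite ltry).
exists (\int[L]_(x in Omega) E (c x) + slope_oo E * z Omega)%E, c, z; split => //.
have z0 A : measurable A -> z A = 0%E by move=> mA; rewrite zE// integral0_eq.
split => //.
  by move=> A mA; rewrite z0// adde0 nuc.
by exists set0; split; rewrite ?measure0// z0// setC0.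
Qed.

Lemma integral_density_scale (nu : fmeasure) (c : rV -> R) (k : R) :
  has_density nu c -> nu (~` Omega) = 0%E ->
  (\int[L]_(x in Omega) (k * c x)%:E = k%:E * nu setT)%E.
Proof.
move=> [[mc c0] nuc] nuO; under eq_integral do rewrite EFinM.
rewrite integralZl//.
  rewrite -nuc//; congr (_ * _)%E; rewrite -(setvU Omega) measureU//.
  - by rewrite [X in (X + _)%E]nuO add0e.
  - exact: measurableC.
  - by rewrite setICl.
apply: (integrableS measurableT) => //; apply/integrableP; split.
  exact/measurable_EFinP.
rewrite (eq_integral (EFin \o c)); last by move=> x _ /=; rewrite ger0_norm.
by rewrite -nuc// -ge0_fin_numE// fin_num_measure.
Qed.

(** On [0, cs] the graph of E lies below its chord from the origin, so the energy is at most the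
    slope of that chord times the mass. *)
Lemma energy_le (nu : fmeasure) (c : rV -> R) (cs e : R) :
  has_density nu c -> nu (~` Omega) = 0%E -> 0 < cs -> E cs = e%:E ->
  (forall x, c x <= cs) ->
  (energy Omega E nu <= (e / cs)%:E * nu setT)%E.
Proof.
move=> nuc nuO cs0 Ecs ccs; rewrite (energy_density nuc).
have [[mc c0] _] := nuc.
rewrite -(integral_density_scale _ nuc nuO); apply: le_integral_measurable => //.
- exact: measurable_convex_density.
- by apply: measurable_funTS; apply/measurable_EFinP; exact: measurable_funM.
- move=> x _; rewrite -{1}(divfK (lt0r_neq0 cs0) (c x)).
  apply: le_trans (convex_scale_le _ (ltW cs0)) _.
    by rewrite divr_ge0 ?(ltW cs0)//= ler_pdivrMr// mul1r.
  by rewrite Ecs -EFinM lee_fin le_eqVlt; apply/orP; left; apply/eqP; ring.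
Qed.

(** Once E is above the line of slope l at a, it stays above it beyond a. Where the density
    vanishes, both integrands are 0. *)
Lemma energy_ge (nu : fmeasure) (c : rV -> R) (a l : R) :
  has_density nu c -> nu (~` Omega) = 0%E -> 0 < a -> ((l * a)%:E <= E a)%E ->
  (forall x, c x = 0 \/ a <= c x) ->
  (l%:E * nu setT <= energy Omega E nu)%E.
Proof.
move=> nuc nuO a0 lE ac; rewrite (energy_density nuc).
have [[mc c0] _] := nuc.
rewrite -(integral_density_scale _ nuc nuO); apply: le_integral_measurable => //.
- by apply: measurable_funTS; apply/measurable_EFinP; exact: measurable_funM.
- exact: measurable_convex_density.
- move=> x _; case: (ac x) => [->|acx]; first by rewrite mulr0 E0.
  have cx : 0 < c x by exact: lt_le_trans acx.
  have /convex_scale_le/(_ (ltW cx)) : 0 <= a / c x <= 1.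
    by rewrite divr_ge0 ?(ltW a0)//= ler_pdivrMr// mul1r.
  rewrite divfK ?gt_eqF// => /(le_trans lE) H.
  have e : ((l * a)%:E = (a / c x)%:E * (l * c x)%:E)%E.
    by rewrite -EFinM; congr EFin; field; rewrite gt_eqF.
  by move: H; rewrite e lee_pmul2l// lte_fin divr_gt0.
Qed.
End rV.
End convex_density.

(** * The energy inequality along cone geodesics *)

Section cone_geodesic.
Variables (R : realType) (d : nat) (Omega : set 'rV[R]_d) (E : R -> \bar R).
Local Notation rV := 'rV[R]_d.
Local Notation L := (@lebesgue_rV R d).
Local Notation fmeasure := {finite_measure set rV -> \bar R}.
Hypotheses (d0 : (0 < d)%N) (cOmega : closed Omega).
Hypotheses (Econv : econvex_on (V := R^o) `[0, +oo[ E) (E0 : E 0 = 0%E).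

Lemma open_measurable_rV (U : set rV) : open U -> measurable U.
Proof. by move=> oU; exact: sub_sigma_algebra. Qed.

Let mOmega : measurable Omega.
Proof.
rewrite -(setCK Omega); apply: measurableC; apply: open_measurable_rV.
exact: closed_openC.
Qed.

Lemma momentZ (b : rV -> R) (k A B : R) : measurable_fun setT b ->
  (forall y, 0 <= b y) -> 0 <= k -> 0 <= A -> 0 <= B ->
  moment b (k * A) (k * B) = (k%:E * moment b A B)%E.
Proof.
move=> mb b0 k0 A0 B0; rewrite /moment -ge0_integralZl_EFin//.
- by apply: eq_integral => y _; rewrite -EFinM; congr EFin; ring.
- by move=> y _; rewrite lee_fin moment_integrand_ge0.
- by apply/measurable_EFinP; exact: measurable_moment.
Qed.

(** The image point of y is at distance atan((r / g) |y|) <= (r / g) |y| < e from x0. *)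
Lemma cone_pushforward_null x0 m D g r e (nu : fmeasure) :
  0 < m -> 0 < g -> 0 < r ->
  (forall x, enorm (x - x0) < e -> Omega x) -> D * (r / g) <= e ->
  cone_pushforward x0 (ball_weight m D) g r nu -> nu (~` Omega) = 0%E.
Proof.
move=> m0 g0 r0 ballO De [nuE _]; rewrite nuE; last exact: measurableC.
apply: integral0_eq => y /= yO; rewrite ball_weightE.
case: ifPn => [/andP[y0 yD]|_]; last by rewrite mul0r.
exfalso; apply: yO; apply: ballO; rewrite enorm_cone_pos//.
have rg : 0 < r / g by rewrite divr_gt0.
have /andP[_ /le_lt_trans] := atan_bounds (mulr_gt0 rg y0); apply.
by apply: lt_le_trans De; rewrite mulrC ltr_pM2r.
Qed.

Variables (x0 : rV) (e : R).
Hypothesis ballO : forall x, enorm (x - x0) < e -> Omega x.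
Hypothesis Gconv : geodesically_convex Omega (energy Omega E).
Variables (g0 g1 r0 r1 : R).
Hypotheses (g0p : 0 < g0) (g1p : 0 < g1) (r0p : 0 < r0) (r1p : 0 < r1).

Let gam (s : R) := (1 - s) * g0 + s * g1.
Let rho (s : R) := (1 - s) * r0 + s * r1.

Lemma convex_comb_gt0 (a b s : R) : 0 < a -> 0 < b -> 0 <= s <= 1 ->
  0 < (1 - s) * a + s * b.
Proof.
move=> a0 b0 /andP[s0 s1]; have [->|sn] := eqVneq s 0.
  by rewrite subr0 mul1r mul0r addr0.
by rewrite ltr_wpDl// ?mulr_gt0 ?mulr_ge0 ?subr_ge0 ?(ltW a0)// lt_def sn.
Qed.

Let gam_gt0 s : 0 <= s <= 1 -> 0 < gam s. Proof. exact: convex_comb_gt0. Qed.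
Let rho_gt0 s : 0 <= s <= 1 -> 0 < rho s. Proof. exact: convex_comb_gt0. Qed.

(** The number [delta] is the ratio of the second to the zeroth moment of the weight: the mass at
    time s is proportional to gam(s)^2 + delta rho(s)^2. The number [l] is a lower bound for E(a) /
    a at the smallest nonzero density a allowed at time t. *)
Lemma cone_geodesic_ineq (t m D T e0 e1 l : R) (k := (d.-1 + 2)%N)
    (cst := fun g r : R => g ^+ (d + 2) / r ^+ d) :
  0 <= t <= 1 -> 0 < m -> 0 < D ->
  (forall s, 0 <= s <= 1 -> D * (rho s / gam s) <= T) -> T <= e ->
  m * (1 + T ^+ 2) ^+ k <= 1 ->
  E (cst g0 r0) = e0%:E -> E (cst g1 r1) = e1%:E ->
  ((l * (m * cst (gam t) (rho t)))%:E <= E (m * cst (gam t) (rho t)))%E ->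
  exists2 delta : R, 0 <= delta <= D ^+ 2 &
    l * (gam t ^+ 2 + delta * rho t ^+ 2) <=
      (1 - t) * (e0 / cst g0 r0 * (g0 ^+ 2 + delta * r0 ^+ 2)) +
      t * (e1 / cst g1 r1 * (g1 ^+ 2 + delta * r1 ^+ 2)).
Proof.
move=> t01 m0 D0 DT Te mT Ee0 Ee1 lE.
pose b : rV -> R := ball_weight m D.
have mb : measurable_fun setT b by exact: measurable_ball_weight.
have b0 y : 0 <= b y by exact: ball_weight_ge0.
have bfin := @ball_weight_fin R d m D m0 D0.
have /choice[mu muP] s := cone_pushforward_exists x0 mb b0 bfin (gam s) (rho s).
have t0' : 0 <= (0 : R) <= 1 by rewrite lexx ler01.
have t1' : 0 <= (1 : R) <= 1 by rewrite lexx ler01.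
have cst0 g r : 0 < g -> 0 < r -> 0 < cst g r.
  by move=> *; rewrite divr_gt0// exprn_gt0.
have muO s : 0 <= s <= 1 -> mu s (~` Omega) = 0%E.
  move=> s01; apply: (cone_pushforward_null m0 _ _ ballO _ (muP s)).
  - exact: gam_gt0.
  - exact: rho_gt0.
  - exact: le_trans (DT s s01) Te.
have muD s : 0 <= s <= 1 -> has_density (mu s) (cone_density x0 m D (gam s) (rho s)).
  move=> s01; split.
    split; first exact: measurable_cone_density.
    exact: cone_density_ge0 m0 (gam_gt0 s01) (rho_gt0 s01).
  move=> A mA.
  exact: (cone_pushforward_density m0 (gam_gt0 s01) (rho_gt0 s01) (muP s) mA).
have geo : hk_geodesic Omega mu.
  split=> [s s01 x xs|s u s01 u01].
    apply: contrapT => xO; have := xs _ (closed_openC cOmega) xO.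
    by rewrite muO// ltxx.
  have HKE v w : 0 <= v <= 1 -> 0 <= w <= 1 -> HK (mu v) (mu w) =
      `|v - w| * Num.sqrt (fine (moment b ((g1 - g0) ^+ 2) ((r1 - r0) ^+ 2))).
    move=> v01 w01; rewrite (HK_cone_pushforward mb b0 bfin _ _ _ _ (muP v) (muP w));
      [|exact: gam_gt0|exact: rho_gt0|exact: gam_gt0|exact: rho_gt0].
    rewrite (_ : gam w - gam v = (v - w) * (g0 - g1)); last by rewrite /gam; ring.
    rewrite (_ : rho w - rho v = (v - w) * (r0 - r1)); last by rewrite /rho; ring.
    rewrite !exprMn momentZ ?sqr_ge0//.
    rewrite fineM// ?moment_fin_num ?sqr_ge0//= sqrtrM ?sqr_ge0// sqrtr_sqr.
    by rewrite -(sqrrN (g0 - g1)) opprB -(sqrrN (r0 - r1)) opprB.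
  by rewrite !HKE// sub0r normrN1 mul1r.
have := Gconv geo t01.
have cE s : 0 <= s <= 1 -> forall x, cone_density x0 m D (gam s) (rho s) x = 0 \/
    m * cst (gam s) (rho s) <= cone_density x0 m D (gam s) (rho s) x <= cst (gam s) (rho s).
  move=> s01 x.
  exact: (cone_density_bounds x0 d0 m0 (gam_gt0 s01) (rho_gt0 s01) x (DT s s01) mT).
have gam0 : gam 0 = g0 by rewrite /gam; ring.
have gam1 : gam 1 = g1 by rewrite /gam; ring.
have rho0 : rho 0 = r0 by rewrite /rho; ring.
have rho1 : rho 1 = r1 by rewrite /rho; ring.
have up s es : 0 <= s <= 1 -> E (cst (gam s) (rho s)) = es%:E ->
    (energy Omega E (mu s) <= (es / cst (gam s) (rho s))%:E * mu s setT)%E.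
  move=> s01 Es; have c0 := cst0 _ _ (gam_gt0 s01) (rho_gt0 s01).
  apply: (energy_le Econv E0 mOmega (muD s s01) (muO s s01) c0 Es) => x.
  by have [->|/andP[]//] := cE s s01 x; exact: ltW.
have U0 := up 0 e0 t0'; rewrite gam0 rho0 in U0.
have U1 := up 1 e1 t1'; rewrite gam1 rho1 in U1.
have Lt : (l%:E * mu t setT <= energy Omega E (mu t))%E.
  have c0 := cst0 _ _ (gam_gt0 t01) (rho_gt0 t01).
  apply: (energy_ge Econv E0 mOmega (muD t t01) (muO t t01) (mulr_gt0 m0 c0) lE) => x.
  by have [->|/andP[? _]] := cE t t01 x; [left|right].
pose B0 := moment b 1 0; pose B1 := moment b 0 1.
have B0f : B0 \is a fin_num by exact: moment_fin_num.
have B1f : B1 \is a fin_num by exact: moment_fin_num.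
have mass s : mu s setT = (gam s ^+ 2 * fine B0 + rho s ^+ 2 * fine B1)%:E.
  rewrite (cone_pushforward_setT (muP s)).
  rewrite [RHS](_ : _ = (gam s ^+ 2)%:E * B0 + (rho s ^+ 2)%:E * B1)%E; last first.
    by rewrite -(fineK B0f) -(fineK B1f) -!EFinM -EFinD.
  rewrite /B0 /B1 -(momentZ mb b0 (sqr_ge0 _) ler01 (lexx 0)).
  rewrite -(momentZ mb b0 (sqr_ge0 (rho s)) (lexx 0) ler01) !mulr1 !mulr0.
  by rewrite momentD ?sqr_ge0// addr0 add0r.
have B0p : 0 < fine B0.
  rewrite fine_gt0//; apply/andP; split; last by rewrite ltey_eq B0f.
  rewrite /B0 /moment; under eq_integral do rewrite mul0r addr0 mulr1.
  exact: ball_weight_gt0.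
have B1p : 0 <= fine B1.
  by rewrite fine_ge0//; apply: integral_ge0 => y _; rewrite lee_fin moment_integrand_ge0.
(* The weight is supported in |y| < D, whence delta <= D^2. *)
have B10 : fine B1 <= D ^+ 2 * fine B0.
  rewrite -lee_fin EFinM !fineK// -(momentZ mb b0 (sqr_ge0 D) ler01 (lexx 0)) mulr1 mulr0.
  apply: ge0_le_integral => //.
  - by move=> y _; rewrite lee_fin moment_integrand_ge0.
  - by apply/measurable_EFinP; exact: measurable_moment.
  - by apply/measurable_EFinP; exact: measurable_moment.
  - move=> y _; rewrite lee_fin add0r mul1r mul0r addr0 /b ball_weightE.
    case: ifPn => [/andP[y0 yD]|_]; last by rewrite !mul0r.
    by rewrite ler_pM2l// ler_pXn2r ?nnegrE ?enorm_ge0// ltW.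
move=> /(le_trans Lt) H.
have /andP[t0 t1] := t01.
have {}H : (l%:E * mu t setT <= (1 - t)%:E * ((e0 / cst g0 r0)%:E * mu 0%R setT)
    + t%:E * ((e1 / cst g1 r1)%:E * mu 1%R setT))%E.
  apply: le_trans H _; apply: leeD; apply: lee_wpmul2l.
  - by rewrite lee_fin subr_ge0.
  - exact: U0.
  - by rewrite lee_fin.
  - exact: U1.
exists (fine B1 / fine B0).
  by rewrite divr_ge0 ?(ltW B0p)//= ler_pdivrMr.
move: H; rewrite !mass gam0 gam1 rho0 rho1 -!EFinM -EFinD lee_fin => H.
rewrite -(ler_pM2r B0p).
rewrite (_ : _ * fine B0 = l * (gam t ^+ 2 * fine B0 + rho t ^+ 2 * fine B1)); last first.
  by field; rewrite gt_eqF.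
apply: le_trans H _; rewrite le_eqVlt; apply/orP; left; apply/eqP.
have c0 := lt0r_neq0 (cst0 _ _ g0p r0p); have c1 := lt0r_neq0 (cst0 _ _ g1p r1p).
by field; rewrite c0 c1 gt_eqF.
Qed.

End cone_geodesic.

(** * Elementary properties of [N_E] *)

Section N_E_theory.
Variables (R : realType) (d : nat) (E : R -> \bar R).
Hypotheses (Econv : econvex_on (V := R^o) `[0, +oo[ E) (E0 : E 0 = 0%E).

Lemma N_E_density (rho gamma : R) : 0 < rho -> 0 < gamma ->
  N_E d E rho gamma = ((gamma ^+ 2 / (gamma ^+ (d + 2) / rho ^+ d))%:E *
    E (gamma ^+ (d + 2) / rho ^+ d))%E.
Proof.
move=> r0 g0; rewrite /N_E; congr (_%:E * _)%E.
rewrite expr_div_n exprD; field.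
by rewrite !expf_neq0 ?gt_eqF.
Qed.

Lemma density_gt0 (rho gamma : R) : 0 < rho -> 0 < gamma ->
  0 < gamma ^+ (d + 2) / rho ^+ d.
Proof. by move=> r0 g0; rewrite divr_gt0// exprn_gt0. Qed.

Lemma N_E_neqNy (rho gamma : R) : 0 < rho -> 0 < gamma -> N_E d E rho gamma != -oo%E.
Proof.
move=> r0 g0; have c0 := density_gt0 r0 g0.
have := Econv.1 _ (ge0_itv (ltW c0)).
rewrite N_E_density//; case: (E _) => // _.
by rewrite mulry gtr0_sg ?mul1e// divr_gt0// exprn_gt0.
Qed.

Lemma N_E_nonincreasing (gamma rho1 rho2 : R) : 0 < gamma -> 0 < rho1 ->
  rho1 <= rho2 -> (N_E d E rho2 gamma <= N_E d E rho1 gamma)%E.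
Proof.
move=> g0 r10 r12; have r20 : 0 < rho2 := lt_le_trans r10 r12.
have c10 := density_gt0 r10 g0.
pose t := rho1 ^+ d / rho2 ^+ d.
have t01 : 0 <= t <= 1.
  rewrite divr_ge0 ?exprn_ge0 ?(ltW r10) ?(ltW r20)//= ler_pdivrMr ?exprn_gt0// mul1r.
  by rewrite lerXn2r ?nnegrE ?(ltW r10) ?(ltW r20).
have := convex_scale_le Econv E0 t01 (ltW c10).
rewrite (_ : t * _ = gamma ^+ (d + 2) / rho2 ^+ d); last first.
  by rewrite /t; field; rewrite !expf_neq0 ?gt_eqF.
move=> H; rewrite /N_E.
have q0 : 0 <= (rho2 / gamma) ^+ d by rewrite exprn_ge0// divr_ge0 ?ltW.
apply: le_trans (lee_wpmul2l _ H) _; first by rewrite lee_fin.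
rewrite muleA -EFinM (_ : _ * t = (rho1 / gamma) ^+ d)//.
by rewrite /t !expr_div_n; field; rewrite !expf_neq0 ?gt_eqF.
Qed.

End N_E_theory.

(** * Small radii and the convexity of [N_E] *)

Section limit.
Variable R : realType.

(** Three conditions valid for all small D > 0: the displaced balls stay in Omega, the lower density
    m c is close to c, and the second-order mass error is below the gap [eta]. *)
Lemma limit_radius (kappa c e Y eta : R) (k : nat) (P : set R) :
  0 < kappa -> 0 < c -> 0 < e -> 0 < eta -> (\forall x \near c, P x) ->
  exists2 D : R, 0 < D & [/\ kappa * D <= e,
    P ((1 + (kappa * D) ^+ 2) ^- k * c) & D ^+ 2 * Y < eta].
Proof.
move=> kappa0 c0 e0 eta0 Pc.
have idc : (x : R) @[x --> 0] --> (0 : R) by exact: cvg_id.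
have H1 : (kappa * x) @[x --> 0^'+] --> (0 : R).
  apply: cvg_at_right_filter; rewrite -[X in _ --> X](mulr0 kappa).
  by apply: cvgM => //; exact: cvg_cst.
have H2 : ((1 + (kappa * x) ^+ 2) ^- k * c) @[x --> 0^'+] --> c.
  have e1 : c = (1 + 0 ^+ 2) ^- k * c by rewrite expr0n addr0 expr1n invr1 mul1r.
  rewrite [X in _ --> X]e1; apply: cvgM; last exact: cvg_cst.
  apply: cvgV; first by rewrite expr0n addr0 expr1n oner_neq0.
  have H : (1 + (kappa * x) ^+ 2) @[x --> 0^'+] --> (1 + 0 ^+ 2 : R).
    apply: cvgD; first exact: cvg_cst.
    apply: (cvg_comp (fun x : R => kappa * x) (fun y : R => y ^+ 2)) H1 _.
    exact: exprn_continuous.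
  apply: (cvg_comp (fun x : R => 1 + (kappa * x) ^+ 2) (fun y : R => y ^+ k)) H _.
  exact: exprn_continuous.
have H3 : (x ^+ 2 * Y) @[x --> 0^'+] --> (0 : R).
  have e2 : 0 = 0 ^+ 2 * Y by rewrite expr0n mul0r.
  rewrite [X in _ --> X]e2; apply: cvgM; last exact: cvg_cst.
  apply: cvg_at_right_filter; exact: exprn_continuous.
have : \forall x \near 0^'+, 0 < x /\ [/\ kappa * x <= e,
    P ((1 + (kappa * x) ^+ 2) ^- k * c) & x ^+ 2 * Y < eta].
  near=> x; split; first by near: x; exact: nbhs_right_gt.
  split.
  - near: x; apply: (cvgr_le _ H1) => //.
  - near: x; exact: H2.
  - near: x; exact: (cvgr_lt _ H3).
by move=> /filter_ex[x [x0 Hx]]; exists x.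
Unshelve. all: by end_near. Qed.

End limit.

Section convexity.
Variables (R : realType) (d : nat) (Omega : set 'rV[R]_d) (E : R -> \bar R).
Local Notation rV := 'rV[R]_d.
Hypotheses (d0 : (0 < d)%N) (cOmega : closed Omega) (iOmega : Omega° !=set0).
Hypothesis Elsc : lower_semicontinuous (E : subspace `[(0 : R), +oo[ -> \bar R).
Hypotheses (Econv : econvex_on (V := R^o) `[0, +oo[ E) (E0 : E 0 = 0%E).
Hypothesis Gconv : geodesically_convex Omega (energy Omega E).

Lemma interior_enorm_ball : exists (x0 : rV) (e : R), 0 < e /\
  forall x, enorm (x - x0) < e -> Omega x.
Proof.
have [x0 /nbhs_ballP[e /= e0 eO]] := iOmega.
exists x0, e; split => // x xe; apply: eO; split => // i j.
rewrite ord1 /ball/= -normrN opprB; apply: le_lt_trans xe.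
by have := ler_coord_enorm (x - x0) j; rewrite !mxE.
Qed.

Lemma lsc_near (c a : R) : 0 < c -> (a%:E < E c)%E ->
  \forall x \near c, (a%:E < E x)%E.
Proof.
move=> c0 aE; have [V cV aV] := Elsc aE.
have c0i : (`[(0 : R), +oo[%classic)° c.
  by rewrite interior_itv_bndy /= in_itv/= c0.
by apply: filterS aV _; rewrite (nbhs_subspace_interior c0i).
Qed.

(** If the inequality failed, the strict gap would survive a slightly smaller slope l at time t, and
    the geodesic inequality for small D would contradict it. *)
Lemma N_E_convex_open (r0 g0 r1 g1 t : R) :
  0 < r0 -> 0 < g0 -> 0 < r1 -> 0 < g1 -> 0 < t < 1 ->
  (N_E d E ((1 - t) * r0 + t * r1) ((1 - t) * g0 + t * g1) <=
   (1 - t)%:E * N_E d E r0 g0 + t%:E * N_E d E r1 g1)%E.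
Proof.
move=> r0p g0p r1p g1p /andP[t0 t1].
have t0' : 0 < 1 - t by rewrite subr_gt0.
have t01 : 0 <= t <= 1 by rewrite !ltW.
have N0 := N_E_neqNy d Econv r0p g0p.
have N1 := N_E_neqNy d Econv r1p g1p.
have c0p := density_gt0 d r0p g0p; have c1p := density_gt0 d r1p g1p.
move: N0 N1; rewrite (N_E_density d E r0p g0p) (N_E_density d E r1p g1p).
set c0 := _ / r0 ^+ d in c0p *; set c1 := _ / r1 ^+ d in c1p *.
have gp := convex_comb_gt0 g0p g1p t01.
have rp := convex_comb_gt0 r0p r1p t01.
rewrite (N_E_density d E rp gp).
have cp := density_gt0 d rp gp.
set g := _ + t * g1 in gp cp *; set r := _ + t * r1 in rp cp *.
set c := _ / r ^+ d in cp *.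
have q0 : 0 < g0 ^+ 2 / c0 by rewrite divr_gt0// exprn_gt0.
have q1 : 0 < g1 ^+ 2 / c1 by rewrite divr_gt0// exprn_gt0.
case E0E : (E c0) => [e0| |] N0 N1; last by move: N0; rewrite mulrNy gtr0_sg ?mul1e.
  2: {
    rewrite [(_ * +oo)%E]mulry gtr0_sg// mul1e mulry gtr0_sg// mul1e addye ?leey//.
    move: N1; case: (_ * _)%E => [s| |]//=; by rewrite mulry gtr0_sg// mul1e. }
case E1E : (E c1) N1 => [e1| |] N1; last by move: N1; rewrite mulrNy gtr0_sg ?mul1e.
  2: by rewrite [(_ * +oo)%E]mulry gtr0_sg// mul1e mulry gtr0_sg// mul1e addey ?leey.
rewrite -!EFinM -EFinD.
pose X := (1 - t) * (g0 ^+ 2 / c0 * e0) + t * (g1 ^+ 2 / c1 * e1).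
have gc : 0 < g ^+ 2 / c by rewrite divr_gt0// exprn_gt0.
rewrite -/X -(@lee_pmul2l _ ((g ^+ 2 / c)^-1)%:E) ?lte_fin ?invr_gt0//.
rewrite muleA -!EFinM mulVf ?gt_eqF// mul1e.
rewrite leNgt; apply/negP => XE.
have [a Xa aE] : exists2 a, (g ^+ 2 / c)^-1 * X < a & (a%:E < E c)%E.
  move: XE; case: (E c) => [s| |]//.
    rewrite lte_fin => Xs; exists (((g ^+ 2 / c)^-1 * X + s) / 2); rewrite ?lte_fin.
      by rewrite midf_lt.
    by rewrite midf_lt.
  by move=> _; exists ((g ^+ 2 / c)^-1 * X + 1); rewrite ?ltrDl ?ltry.
(* A slope strictly between that of the right-hand side and a / c: it keeps the gap l g^2 - X
   positive and, as l c < a < E c, stays below E(x) / x for x near c by lower semicontinuity. *)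
pose l := (X / g ^+ 2 + a / c) / 2.
have Xl : X < l * g ^+ 2.
  rewrite -ltr_pdivrMr ?exprn_gt0// /l midf_lt//.
  rewrite ltr_pdivlMr//; apply: le_lt_trans Xa; rewrite le_eqVlt; apply/orP; left.
  by apply/eqP; field; rewrite !gt_eqF ?exprn_gt0.
have la : l * c < a.
  rewrite -ltr_pdivlMr// /l midf_lt//.
  rewrite ltr_pdivlMr//; apply: le_lt_trans Xa; rewrite le_eqVlt; apply/orP; left.
  by apply/eqP; field; rewrite !gt_eqF ?exprn_gt0.
have nearE : \forall x \near c, ((l * x)%:E <= E x)%E.
  have H1 : \forall x \near c, l * x < a.
    have H : (l * x) @[x --> c] --> l * c by apply: cvgM; [exact: cvg_cst|exact: cvg_id].
    exact: (cvgr_lt _ H).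
  near=> x; apply/ltW/(@lt_trans _ _ a%:E).
    by rewrite lte_fin; near: x.
  by near: x; exact: lsc_near.
have [x0 [e [ep ballO]]] := interior_enorm_ball.
(* Bound on rho_s / gamma_s for all s in [0, 1], so that T = kappa D bounds every tangent
   reached. *)
pose kappa := (r0 + r1) * (g0^-1 + g1^-1).
have kp : 0 < kappa by rewrite mulr_gt0// addr_gt0// invr_gt0.
(* Net coefficient of [delta] in [cone_geodesic_ineq], which then reads l g^2 - X <= delta Y. *)
pose Y := (1 - t) * (e0 / c0 * r0 ^+ 2) + t * (e1 / c1 * r1 ^+ 2) - l * r ^+ 2.
have [D D0 [kDe ED DY]] :=
  @limit_radius R kappa c e `|Y| (l * g ^+ 2 - X) (d.-1 + 2) _ kp cp ep
    ltac:(by rewrite subr_gt0) nearE.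
have T1 : 0 < 1 + (kappa * D) ^+ 2 by rewrite ltr_pwDl// sqr_ge0.
have m0 : 0 < (1 + (kappa * D) ^+ 2) ^- (d.-1 + 2) by rewrite invr_gt0 exprn_gt0.
have mT : (1 + (kappa * D) ^+ 2) ^- (d.-1 + 2) * (1 + (kappa * D) ^+ 2) ^+ (d.-1 + 2) <= 1.
  by rewrite mulVf// expf_neq0// gt_eqF.
have DT s : 0 <= s <= 1 ->
    D * (((1 - s) * r0 + s * r1) / ((1 - s) * g0 + s * g1)) <= kappa * D.
  move=> s01; have /andP[s0 s1] := s01; rewrite [leRHS]mulrC ler_pM2l//.
  have gs := convex_comb_gt0 g0p g1p s01; have rs := convex_comb_gt0 r0p r1p s01.
  apply: ler_pM; rewrite ?invr_ge0 ?(ltW gs) ?(ltW rs)//.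
    by apply: lerD; rewrite ger_pMl// lerBlDr lerDl.
  have [g01|/ltW g10] := leP g0 g1.
    apply: (@le_trans _ _ g0^-1); last by rewrite lerDl invr_ge0 ltW.
    by rewrite lef_pV2 ?posrE//; nra.
  apply: (@le_trans _ _ g1^-1); last by rewrite lerDr invr_ge0 ltW.
  by rewrite lef_pV2 ?posrE//; nra.
have [delta /andP[de0 deD]] := cone_geodesic_ineq d0 cOmega Econv E0 ballO Gconv
  g0p g1p r0p r1p t01 m0 D0 DT kDe mT E0E E1E ED.
rewrite -/g -/r -/c0 -/c1 => H.
have : l * g ^+ 2 - X <= delta * Y.
  rewrite (_ : X = (1 - t) * (e0 / c0 * g0 ^+ 2) + t * (e1 / c1 * g1 ^+ 2)).
    by rewrite /Y; lra.
  by rewrite /X; ring.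
have : delta * Y <= D ^+ 2 * `|Y|.
  apply: (@le_trans _ _ (delta * `|Y|)).
    by rewrite ler_wpM2l// ler_norm.
  by rewrite ler_wpM2r.
by lra.
Unshelve. all: by end_near. Qed.

End convexity.

Theorem theorem7p5 (R : realType) (d : nat) (Omega : set 'rV[R]_d)
    (E : R -> \bar R) :
  (0 < d)%N ->
  closed Omega -> convex_set Omega -> Omega° !=set0 ->
  lower_semicontinuous (E : subspace `[(0 : R), +oo[ -> \bar R) ->
  econvex_on (V := R^o) `[0, +oo[ E ->
  E 0 = 0%E ->
  (exists2 c0 : R, 0 < c0 & (E c0 < +oo)%E) ->
  C2_on (dom_interior E) (fine \o E) ->
  (slope_0 E = -oo%E -> bounded_set Omega) ->
  geodesically_convex Omega (energy Omega E) ->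
  econvex_on (V := (R^o * R^o)%type) [set p | 0 < p.1 /\ 0 < p.2]
    (fun p => N_E d E p.1 p.2) /\
  (forall gamma : R, 0 < gamma -> forall rho1 rho2 : R,
    0 < rho1 -> rho1 <= rho2 ->
    ((d%:R - 1)%:E * N_E d E rho2 gamma
     <= (d%:R - 1)%:E * N_E d E rho1 gamma)%E).
Proof.
move=> d0 cOmega _ iOmega Elsc Econv E0 _ _ _ Gconv; split; last first.
  move=> gamma g0 rho1 rho2 r10 r12; apply: lee_wpmul2l.
    by rewrite lee_fin subr_ge0 ler1n.
  exact: N_E_nonincreasing.
split=> [[r g] /= [r0 g0]|[r0 g0] [r1 g1] t /= [r0p g0p] [r1p g1p] /andP[t0 t1]].
  exact: N_E_neqNy.
(* For t = 0 and t = 1 the factor 0 cancels a possibly infinite value of [N_E]; for 0 < t < 1 an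
   infinite value makes the right-hand side infinite. *)
have [->|tn0] := eqVneq t 0.
  by rewrite subr0 !scale1r !scale0r !addr0 mul0e adde0 mul1e.
have [->|tn1] := eqVneq t 1.
  by rewrite subrr !scale1r !scale0r !add0r mul0e add0e mul1e.
apply: (N_E_convex_open d0 cOmega iOmega Elsc Econv E0 Gconv) => //.
by rewrite lt_def tn0 t0/= lt_neqAle tn1.
Qed.
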